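(* Let $R$ be a commutative noetherian local ring and $M$ a finitely generated $R$-module of finite G-dimension. The following conditions are equivalent. (i) $\chi^{\mathcal{G}}(M)=0$. (ii) $\operatorname{pdim}_R(M)$ is finite and $\operatorname{Ann}_R(M)$ contains an $R$-regular element.
   Context: Let $(R,\mathfrak{m},k)$ be a commutative noetherian local ring and set $(-)^*=\operatorname{Hom}_R(-,R)$. A finitely generated $R$-module $G$ is totally reflexive if the biduality map $G\to G^{**}$ is bijective and $\operatorname{Ext}^i_R(G,R)=0=\operatorname{Ext}^i_R(G^*,R)$ for all $i\neq 0$. A G-resolution of a finitely generated module $M$ is a complex $G$ of totally reflexive modules with $G_n=0$ for $n<0$, $H_n(G)=0$ for $n>0$ and $H_0(G)\cong M$; its augmented G-resolution $G^+$ is the exact sequence $\cdots\to G_1\to G_0\to M\to 0$. The G-dimension is $\operatorname{G-dim}_R(M)=\inf\{\sup\{n\geq 0\mid G_n\neq 0\}\mid G \text{ is a G-resolution of } M\}$. A G-resolution $G$ is proper if $\operatorname{Hom}_R(H,G^+)$ is exact for every totally reflexive $R$-module $H$. Every finitely generated $M$ of finite G-dimension has a bounded proper G-resolution, and proper G-resolutions are unique up to homotopy equivalence, so $\operatorname{Tor}^{\mathcal{G}}_n(M,N)=H_n(G\otimes_R N)$, with $G$ a proper G-resolution of $M$, is well defined. The relative Betti numbers are $\beta_n^{\mathcal{G}}(M)=\dim_k\operatorname{Tor}_n^{\mathcal{G}}(M,k)$, which vanish for $n<0$ and $n>\operatorname{G-dim}_R(M)$. The G-Euler characteristic of $M$ is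 $\chi^{\mathcal{G}}(M)=\sum_{n\geq 0}(-1)^n\beta_n^{\mathcal{G}}(M)$. Here $\operatorname{pdim}_R$ denotes projective dimension, and an $R$-regular element is a nonzerodivisor on $R$. *)

(* Defs.v *)
From HB Require Import structures.
From mathcomp Require Import all_boot all_order all_algebra generic_quotient.
From mathcomp Require Import ring_quotient freeg.
From mathcomp Require Import boolp classical_sets functions cardinality fsbigop.
Set Implicit Arguments.
Unset Strict Implicit.
Unset Printing Implicit Defensive.
Import GRing.Theory.
Local Open Scope ring_scope.
Local Open Scope quotient_scope.

(* Ideals and submodules are boolean predicates, as in MathComp; classically
   every subset is one, through `[< _ >]. *)

Definition maximal_ideal (R : comNzRingType) (m : {pred R}) : Prop :=
  idealr_closed m /\
  forall J : {pred R}, idealr_closed J -> {subset m <= J} -> {subset J <= m}.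

Definition local_ring (R : comNzRingType) (m : {pred R}) : Prop :=
  maximal_ideal m /\ forall n : {pred R}, maximal_ideal n -> n =i m.

Section Span.
Variables (R : pzRingType) (V : lmodType R) (S : {pred V}).

Definition span : {pred V} :=
  fun x => `[< forall U : {pred V},
                 submod_closed U -> {subset S <= U} -> x \in U >].

Lemma span_submod_closed : submod_closed span.
Proof.
split=> [|a x y /asboolP hx /asboolP hy]; apply/asboolP => U hU SU.
  by case: hU.
by case: (hU) => _; apply; [apply: hx | apply: hy].
Qed.
HB.instance Definition _ :=
  GRing.isSubmodClosed.Build R V span span_submod_closed.

Lemma mem_span x : x \in S -> x \in span.
Proof. by move=> Sx; apply/asboolP => U _; apply. Qed.

Lemma span_min (U : {pred V}) :
  submod_closed U -> {subset S <= U} -> {subset span <= U}.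
Proof. by move=> hU SU x /asboolP; apply. Qed.

End Span.

Definition fin_gen (R : pzRingType) (V : lmodType R) : Prop :=
  exists s : seq V, forall x : V, x \in span (mem s).

Definition noetherian (R : comNzRingType) : Prop :=
  forall I : {pred R^o}, submod_closed I ->
    exists s : seq R^o, I =i span (mem s).

(* V / <S>; taking the span makes the quotient total in S, and it changes
   nothing when S is already a submodule. *)
Definition modquot (R : pzRingType) (V : lmodType R) (S : {pred V}) : Type :=
  (Quotient.quot (span S)).

Section ModQuot.
Variables (R : pzRingType) (V : lmodType R) (S : {pred V}).
Notation Q := (modquot S).

HB.instance Definition _ := GRing.Zmodule.on Q.

Definition mqpi (x : V) : Q := \pi_(Quotient.quot (span S)) x.

Lemma mqpi_eq x y : (mqpi x = mqpi y) <-> (x - y \in span S).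
Proof. by rewrite Quotient.idealrBE; split => /eqP. Qed.

Lemma mqpi_repr (q : Q) : mqpi (repr q) = q.
Proof. exact: (@reprK _ (Quotient.quot (span S))). Qed.

Lemma mqpiD : {morph mqpi : x y / x + y}.
Proof. by move=> x y; rewrite /mqpi [LHS]raddfD. Qed.

Definition mqscale (a : R) (q : Q) : Q := mqpi (a *: repr q).

Lemma mqscale_pi a x : mqscale a (mqpi x) = mqpi (a *: x).
Proof.
apply/mqpi_eq; rewrite -scalerBr rpredZ //.
by apply/mqpi_eq; rewrite mqpi_repr.
Qed.

Fact mqscaleA a b q : mqscale a (mqscale b q) = mqscale (a * b) q.
Proof. by rewrite -[q]mqpi_repr !mqscale_pi scalerA. Qed.
Fact mqscale1 : left_id 1 mqscale.
Proof. by move=> q; rewrite -[q]mqpi_repr mqscale_pi scale1r. Qed.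
Fact mqscaleDr : right_distributive mqscale +%R.
Proof.
move=> a q p; rewrite -[q]mqpi_repr -[p]mqpi_repr.
by rewrite -mqpiD !mqscale_pi -mqpiD scalerDr.
Qed.
Fact mqscaleDl q : {morph mqscale^~ q : a b / a + b}.
Proof. by move=> a b; rewrite -[q]mqpi_repr !mqscale_pi -mqpiD scalerDl. Qed.
HB.instance Definition _ := GRing.Zmodule_isLmodule.Build R Q
  mqscaleA mqscale1 mqscaleDr mqscaleDl.

Fact mqpi_is_linear : linear mqpi.
Proof. by move=> a x y; rewrite mqpiD -mqscale_pi. Qed.
HB.instance Definition _ := GRing.isLinear.Build R V Q *:%R mqpi mqpi_is_linear.

End ModQuot.

Section QuotLift.
Variables (R : pzRingType) (V W : lmodType R) (S : {pred V}).
Variables (f : {linear V -> W}) (fS : forall x, x \in S -> f x = 0).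

Definition mqlift of (forall x, x \in S -> f x = 0) :=
  fun q : modquot S => f (repr q).

Lemma mqlift_pi x : mqlift fS (mqpi S x) = f x.
Proof.
apply/eqP; rewrite -subr_eq0 -linearB; apply/eqP.
set y := _ - x; have: y \in span S by apply/mqpi_eq; rewrite mqpi_repr.
move=> Sy; apply/eqP.
apply: (@span_min _ _ S [pred z | f z == 0]) Sy.
  split=> [|a u v]; rewrite !inE ?linear0 // => /eqP fu /eqP fv.
  by rewrite linearP fu fv scaler0 addr0.
by move=> z Sz; rewrite inE fS.
Qed.

Fact mqlift_is_linear : linear (mqlift fS).
Proof.
move=> a p q; rewrite -[p]mqpi_repr -[q]mqpi_repr -linearP !mqlift_pi.
by rewrite linearP.
Qed.
HB.instance Definition _ :=
  GRing.isLinear.Build R (modquot S) W *:%R (mqlift fS) mqlift_is_linear.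
End QuotLift.

Section Kernel.
Variables (R : pzRingType) (V W : lmodType R) (f : {linear V -> W}).

Definition kerp : {pred V} := fun x => f x == 0.
Fact kerp_submod_closed : submod_closed kerp.
Proof.
split=> [|a u v]; rewrite !unfold_in ?linear0 // => /eqP fu /eqP fv.
by rewrite linearP fu fv scaler0 addr0.
Qed.
HB.instance Definition _ :=
  GRing.isSubmodClosed.Build R V kerp kerp_submod_closed.

Record kermod := KerMod { ker_val : V; _ : ker_val \in kerp }.
HB.instance Definition _ := [isSub for ker_val].
HB.instance Definition _ := [Choice of kermod by <:].
HB.instance Definition _ := [SubChoice_isSubLmodule of kermod by <:].
End Kernel.

(* ker g / (im f :&: ker g); for a complex A -f-> B -g-> C this is the homology
   at B. *)
Definition homology (R : pzRingType) (A B C : lmodType R)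
    (f : {linear A -> B}) (g : {linear B -> C}) : lmodType R :=
  modquot (fun z : kermod g => `[< exists a : A, val z = f a >]).

Definition zero_mod (R : pzRingType) (V : lmodType R) : Prop :=
  forall x : V, x = 0.

Section Hom.
Variables (R : comNzRingType) (M N : lmodType R).

Definition linearp : {pred M -> N} := fun f => `[< linear f >].
Fact linearp_submod_closed : submod_closed linearp.
Proof.
split=> [|a f g /asboolP fl /asboolP gl]; apply/asboolP => b x y.
  by rewrite scaler0 addr0.
have fE z : (a *: f + g) z = a *: f z + g z by [].
by rewrite !fE fl gl !scalerDr !scalerA mulrC addrACA.
Qed.
HB.instance Definition _ :=
  GRing.isSubmodClosed.Build R (M -> N) linearp linearp_submod_closed.

Record hom := Hom { hom_val :> M -> N; _ : hom_val \in linearp }.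
HB.instance Definition _ := [isSub for hom_val].
HB.instance Definition _ := [Choice of hom by <:].
HB.instance Definition _ := [SubChoice_isSubLmodule of hom by <:].

Fact hom_is_linear (f : hom) : linear f.
Proof. by case: f => f /= /asboolP. Qed.
HB.instance Definition _ (f : hom) :=
  GRing.isLinear.Build R M N *:%R f (hom_is_linear f).

Definition to_hom (f : {linear M -> N}) : hom :=
  @Hom f (asboolT (linearP f : linear f)).
End Hom.

Section HomMap.
Variables (R : comNzRingType) (A B N : lmodType R) (f : {linear A -> B}).

Definition hom_map (u : hom B N) : hom A N := to_hom (u \o f).

Fact hom_map_is_linear : linear hom_map.
Proof. by move=> a u v; apply/val_inj/funext => x. Qed.
HB.instance Definition _ :=
  GRing.isLinear.Build R (hom B N) (hom A N) *:%R hom_map hom_map_is_linear.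
End HomMap.
Arguments hom_map {R A B} N f u.

Section Dual.
Variables (R : comNzRingType) (M : lmodType R).

Definition dual : lmodType R := hom M R^o.

Definition eval_at (x : M) : dual -> R^o := fun u => (u : hom M R^o) x.
Fact eval_at_is_linear x : linear (eval_at x).
Proof. by []. Qed.
HB.instance Definition _ x :=
  GRing.isLinear.Build R dual R^o *:%R (eval_at x) (eval_at_is_linear x).
End Dual.

Definition biduality (R : comNzRingType) (M : lmodType R) (x : M) :
  dual (dual M) := to_hom (eval_at x).

Section FreeLift.
Variables (R : comNzRingType) (K : choiceType) (V : lmodType R) (f : K -> V).

Fact fglift_is_linear : linear (fglift f : {freeg K / R} -> V).
Proof.
have fgliftD : {morph fglift f : x y / x + y}.
  have fgliftB := lift_is_additive f.
  have fglift0 : fglift f 0 = 0 by rewrite -(subr0 0) fgliftB subrr.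
  by move=> x y; rewrite -{1}[y]opprK fgliftB -[- y]sub0r fgliftB fglift0 sub0r
                         opprK.
have fgliftS (I : Type) (s : seq I) (F : I -> {freeg K / R}) :
    fglift f (\sum_(i <- s) F i) = \sum_(i <- s) fglift f (F i).
  apply: (big_morph _ fgliftD).
  by have := lift_is_additive f 0 0; rewrite !subrr.
move=> a x y; rewrite fgliftD; congr (_ + _).
rewrite -[x]freeg_sumE scaler_sumr !fgliftS scaler_sumr; apply: eq_bigr => z _.
have -> k : a *: << k *g z >> = << a * k *g z >> :> {freeg K / R}.
  by apply/eqP/freeg_eqP => t; rewrite coeffZ !coeffU mulrA.
by rewrite !liftU scalerA.
Qed.
HB.instance Definition _ :=
  GRing.isLinear.Build R {freeg K / R} V *:%R (fglift f) fglift_is_linear.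
End FreeLift.

Section Tensor.
Variables (R : comNzRingType) (M N : lmodType R).

Definition tensor_rel : {pred {freeg (M * N)%type / R}} := fun z => `[<
  [\/ exists x x' y, z = << (x + x', y) >> - << (x, y) >> - << (x', y) >>,
      exists x y y', z = << (x, y + y') >> - << (x, y) >> - << (x, y') >>,
      exists a x y, z = << (a *: x, y) >> - a *: << (x, y) >>
    | exists a x y, z = << (x, a *: y) >> - a *: << (x, y) >>] >].

Definition tensor : lmodType R := modquot tensor_rel.

Definition pure_tensor (x : M) (y : N) : tensor := mqpi tensor_rel << (x, y) >>.

End Tensor.

Section TensorMap.
Variables (R : comNzRingType) (A B N : lmodType R) (f : {linear A -> B}).

Definition pretensor_map : {linear {freeg (A * N)%type / R} -> tensor B N} :=
  fglift (fun p : A * N => pure_tensor (f p.1) p.2).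

Fact pretensor_map_rel z : z \in @tensor_rel R A N -> pretensor_map z = 0.
Proof.
have liftE (p : A * N) :
    pretensor_map << p >> = mqpi (@tensor_rel R B N) << (f p.1, p.2) >>.
  by rewrite /pretensor_map /= liftU scale1r.
have relE u : u \in @tensor_rel R B N -> mqpi (@tensor_rel R B N) u = 0.
  by move=> hu; rewrite -(linear0 (mqpi _)); apply/mqpi_eq; rewrite subr0 mem_span.
case/asboolP => -[a [b [c ->]]]; rewrite !linearB ?linearZ /= !liftE /= -?linearZ -!linearB;
  apply: relE; apply/asboolP.
- by constructor 1; exists (f a), (f b), c; rewrite linearD.
- by constructor 2; exists (f a), b, c.
- by constructor 3; exists a, (f b), c; rewrite linearZ.
- by constructor 4; exists a, (f b), c.
Qed.

Definition tensor_map : {linear tensor A N -> tensor B N} :=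
  mqlift pretensor_map_rel.

Lemma tensor_map_pure (x : A) (y : N) :
  tensor_map (pure_tensor x y) = pure_tensor (f x) y.
Proof.
apply: etrans (mqlift_pi pretensor_map_rel _) _.
by rewrite /pretensor_map /= liftU scale1r.
Qed.
End TensorMap.
Arguments tensor_map {R A B} N f.

(* Chain complexes in nonnegative degrees: [cdiff C n] is the differential in
   degree n.+1. *)
Record complex (R : pzRingType) := Complex {
  cterm :> nat -> lmodType R;
  cdiff : forall n, {linear cterm n.+1 -> cterm n};
  cdiffK : forall n x, cdiff n (cdiff n.+1 x) = 0 }.

(* The differential out of degree n; in degree 0 it is zero. *)
Definition cdiff_out (R : pzRingType) (C : complex R) (n : nat) :
    {linear C n -> C n.-1} :=
  match n with 0 => \0 | n'.+1 => cdiff C n' end.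

Record augmented (R : pzRingType) (M : lmodType R) := Augmented {
  aug_complex :> complex R;
  aug : {linear aug_complex 0%N -> M};
  aug_diff : forall x, aug (cdiff aug_complex 0%N x) = 0 }.

Section Resolutions.
Variables (R : comNzRingType) (M : lmodType R).
Implicit Types (P : lmodType R -> Prop) (X : augmented M).

(* Exactness of ... -> X_1 -> X_0 -> M -> 0, i.e. H_n(X) = 0 for n > 0 and
   H_0(X) is identified with M by the augmentation. *)
Definition aug_exact X : Prop :=
  [/\ forall n (x : X n.+1), cdiff X n x = 0 -> exists y, x = cdiff X n.+1 y,
      forall x : X 0%N, aug X x = 0 -> exists y, x = cdiff X 0%N y
    & forall x : M, exists y, x = aug X y].

Definition resolution P X : Prop := (forall n, P (X n)) /\ aug_exact X.

Definition res_dim_le P (d : nat) : Prop :=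
  exists2 X : augmented M, resolution P X &
    forall n, (d < n)%N -> zero_mod (X n).

(* The infimum over the P-resolutions of M of their lengths is finite; the zero
   module, of dimension -oo, is included. *)
Definition finite_res_dim P : Prop := exists d : nat, res_dim_le P d.

(* Exactness of Hom(H, X^+). *)
Definition hom_aug_exact (H : lmodType R) X : Prop :=
  [/\ forall n (u : {linear H -> X n.+1}), (forall h, cdiff X n (u h) = 0) ->
        exists v : {linear H -> X n.+2}, forall h, u h = cdiff X n.+1 (v h),
      forall u : {linear H -> X 0%N}, (forall h, aug X (u h) = 0) ->
        exists v : {linear H -> X 1%N}, forall h, u h = cdiff X 0%N (v h)
    & forall u : {linear H -> M},
        exists v : {linear H -> X 0%N}, forall h, u h = aug X (v h)].
End Resolutions.

Definition projective (R : comNzRingType) (P : lmodType R) : Prop :=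
  forall (A B : lmodType R) (p : {linear A -> B}) (u : {linear P -> B}),
    (forall b, exists a, b = p a) ->
    exists v : {linear P -> A}, forall x, u x = p (v x).

Definition finite_pdim (R : comNzRingType) (M : lmodType R) : Prop :=
  finite_res_dim M (@projective R).

(* H^n(Hom(C, N)). *)
Definition cohomology (R : comNzRingType) (C : complex R) (N : lmodType R)
    (n : nat) : lmodType R :=
  homology (hom_map N (cdiff_out C n)) (hom_map N (cdiff C n)).

(* Ext^n(M, N) = 0; Ext does not depend on the projective resolution of M, and
   every module has one. *)
Definition ext_zero (R : comNzRingType) (M N : lmodType R) (n : nat) : Prop :=
  exists2 X : augmented M, resolution (@projective R) X &
    zero_mod (cohomology X N n).

Definition totally_reflexive (R : comNzRingType) (G : lmodType R) : Prop :=
  [/\ fin_gen G, bijective (@biduality R G)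
    & forall n, n != 0%N -> ext_zero G R^o n /\ ext_zero (dual G) R^o n].

Definition finite_Gdim (R : comNzRingType) (M : lmodType R) : Prop :=
  finite_res_dim M (@totally_reflexive R).

Definition proper_Gresolution (R : comNzRingType) (M : lmodType R)
    (X : augmented M) : Prop :=
  resolution (@totally_reflexive R) X /\
  forall H : lmodType R, totally_reflexive H -> hom_aug_exact H X.

(* H_n(C (x) N). *)
Definition tensor_homology (R : comNzRingType) (C : complex R) (N : lmodType R)
    (n : nat) : lmodType R :=
  homology (tensor_map N (cdiff C n)) (tensor_map N (cdiff_out C n)).

Definition residue_field (R : comNzRingType) (m : {pred R}) : lmodType R :=
  modquot (m : {pred R^o}).

(* V is a vector space of dimension d over R/m: m annihilates V, and V has an
   R/m-basis with d elements.  The coefficients are written in R, a coefficient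
   being zero in R/m when it lies in m. *)
Definition has_kdim (R : comNzRingType) (m : {pred R}) (V : lmodType R)
    (d : nat) : Prop :=
  (forall a (v : V), a \in m -> a *: v = 0) /\
  exists e : 'I_d -> V,
    (forall v, exists a : 'I_d -> R, v = \sum_(i < d) a i *: e i) /\
    (forall a : 'I_d -> R,
       \sum_(i < d) a i *: e i = 0 -> forall i, a i \in m).

(* dim_k Tor^G_n(M, k), computed from a proper G-resolution of M; it does not
   depend on the choice, and is 0 by convention if there is none. *)
Definition Gbetti (R : comNzRingType) (m : {pred R}) (M : lmodType R)
    (n : nat) : nat :=
  xget 0%N [set d : nat | exists2 X : augmented M, proper_Gresolution X &
              has_kdim m (tensor_homology X (residue_field m) n) d].

(* A sum with finite support when M has finite G-dimension. *)
Definition Geuler (R : comNzRingType) (m : {pred R}) (M : lmodType R) : int :=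
  \sum_(n \in [set: nat]) (-1) ^+ n * (Gbetti m M n)%:Z.

Definition Ann (R : comNzRingType) (M : lmodType R) : set R :=
  [set r | forall x : M, r *: x = 0].

(* Main.v *)
(** Let K -> G -> M be exact with G totally reflexive and K of finite free
    resolution (Auslander-Buchweitz).  Splicing gives a proper G-resolution, so
    the G-Euler characteristic of M is g - c, where g is the number of minimal
    generators of G and c the alternating sum of the ranks resolving K.  At an
    associated prime of R, that is, up to multiplication by a scalar outside
    p = Ann(s), K is free of rank c.  If c = g, then composing R^c -> K -> G with
    a lift to R^g gives a square matrix whose determinant is not in p and kills
    M; it also follows that R^g -> G is injective locally at p.  As this holds for
    every associated prime, G is free and Ann(M) contains a regular element.
    Conversely, if M has a finite free resolution, its rank at an associated prime
    is the Euler characteristic, and a regular element killing M makes it zero. *)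

Require Import Defs.
From HB Require Import structures.
From mathcomp Require Import all_boot all_order all_algebra generic_quotient.
From mathcomp Require Import ring_quotient fraction freeg ring.
From mathcomp Require Import boolp classical_sets fsbigop.
(* Again, because all_algebra shadows [span]. *)
Require Import Defs.
Set Implicit Arguments.
Unset Strict Implicit.
Unset Printing Implicit Defensive.
Import GRing.Theory.
Local Open Scope ring_scope.

(** * Exact sequences and free modules *)

(** If p = Ann(s) is an associated prime, multiplication by s embeds R/p in R. So a matrix over R
    which is injective on the multiples of s has independent rows modulo p, and once it is square
    its determinant lies outside p. This is how R_p, having depth 0, forces modules of finite free
    resolution to be free; adjugates and scalars outside p stand in for the localization. The
    spliced resolution is proper because Ext^1(H, K) = 0 for H totally reflexive and K of finite
    free resolution. This vanishing is expressed by extension of maps ([ext1]), which spares the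
    choice of resolutions. Total reflexivity is recognised by membership in a class stable under
    syzygies and cosyzygies, so that closure under extensions becomes a double horseshoe argument.
    In the alternating sum of relative Betti numbers the ranks of the differentials cancel. Hence
    any free modules may resolve K, while the cover R^g of G is minimal so that g is the dimension
    of the tensor product of G with k. *)

Lemma dependent_choice_rel (T : nat -> Type)
    (E : forall n, T n -> T n.+1 -> Prop) (x0 : T 0%N) :
  (forall n x, exists y, @E n x y) ->
  exists2 s : forall n, T n, s 0%N = x0 & forall n, E n (s n) (s n.+1).
Proof.
move=> H; pose f n x := projT1 (cid (H n x)).
pose s := fix s n : T n := if n is n'.+1 then f n' (s n') else x0.
by exists s => // n; apply: (projT2 (cid (H n (s n)))).
Qed.

Section MkLinear.
Variables (R : pzRingType) (V W : lmodType R) (f : V -> W) (fL : linear f).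
(** The proof of linearity is an argument so that the linear structure can be inferred from the term
    itself. *)
Definition mklin_fun of linear f := f.
HB.instance Definition _ :=
  GRing.isLinear.Build R V W *:%R (mklin_fun fL) fL.
Definition mklin : {linear V -> W} := mklin_fun fL.
End MkLinear.

Lemma submod_closed_span (R : pzRingType) (V : lmodType R) (S : {pred V}) :
  submod_closed S -> span S =i S.
Proof.
move=> hS x; apply/idP/idP; last exact: mem_span.
exact: (span_min hS).
Qed.

Section Exact.
Variable R : comNzRingType.
Implicit Types A B C U V W : lmodType R.

Definition short_exact A B C (i : {linear A -> B}) (p : {linear B -> C}) : Prop :=
  [/\ injective i, forall b, p b = 0 <-> exists a, b = i a
    & forall c, exists b, c = p b].

Lemma linear_injP V W (f : {linear V -> W}) :
  (forall x, f x = 0 -> x = 0) -> injective f.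
Proof.
move=> h x y xy; apply/eqP; rewrite -subr_eq0; apply/eqP; apply: h.
by rewrite linearB xy subrr.
Qed.

Lemma linear_bij_inv V W (f : {linear V -> W}) : bijective f ->
  exists2 g : {linear W -> V}, cancel f g & cancel g f.
Proof.
case=> g fg gf; have gL : linear g by move=> a x y; apply: (can_inj fg); rewrite linearP !gf.
by exists (mklin gL).
Qed.

Lemma linear_bijP V W (f : {linear V -> W}) :
  injective f -> (forall y, exists x, y = f x) -> bijective f.
Proof.
move=> fi /choice[g fg]; exists g => // x; first by apply: fi; rewrite -fg.
Qed.

Lemma lift_inj V A B (i : {linear A -> B}) (f : {linear V -> B}) :
  injective i -> (forall x, exists a, f x = i a) ->
  exists g : {linear V -> A}, forall x, f x = i (g x).
Proof.
move=> ii /choice[g fg].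
have gL : linear g by move=> a x y; apply: ii; rewrite -fg !linearP -!fg.
by exists (mklin gL).
Qed.

Lemma factor_surj V B C (p : {linear B -> C}) (f : {linear B -> V}) :
  (forall c, exists b, c = p b) -> (forall x, p x = 0 -> f x = 0) ->
  exists g : {linear C -> V}, forall x, f x = g (p x).
Proof.
move=> /choice[s ps] fp.
have fE x y : p x = p y -> f x = f y.
  move=> xy; apply/eqP; rewrite -subr_eq0 -linearB fp //.
  by rewrite linearB xy subrr.
have gL : linear (f \o s).
  by move=> a x y /=; rewrite -linearP; apply: fE; rewrite linearP -!ps.
by exists (mklin gL) => x; apply: fE; rewrite -ps.
Qed.

Lemma zero_mod_modquot V (S : {pred V}) :
  zero_mod (modquot S : lmodType R) <-> forall x, x \in span S.
Proof.
split=> [h x|h q]; first by rewrite -(subr0 x) -mqpi_eq linear0; apply: h.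
by rewrite -[q]mqpi_repr -(linear0 (mqpi S)); apply/mqpi_eq; rewrite subr0.
Qed.

Lemma mqpi_eq0 V (S : {pred V}) x : mqpi S x = 0 <-> x \in span S.
Proof. by rewrite -{2}(subr0 x) -mqpi_eq linear0. Qed.

Lemma mqpi_surj V (S : {pred V}) (q : modquot S) : exists x, q = mqpi S x.
Proof. by exists (repr q); rewrite mqpi_repr. Qed.

Lemma image_submod_closed V W (f : {linear V -> W}) :
  submod_closed (fun y : W => `[< exists x, y = f x >] : bool).
Proof.
split=> [|a u v /asboolP[x ->] /asboolP[y ->]]; apply/asboolP.
  by exists 0; rewrite linear0.
by exists (a *: x + y); rewrite linearP.
Qed.

Lemma homology_image_closed A B C (f : {linear A -> B}) (g : {linear B -> C}) :
  submod_closed (fun z : kermod g => `[< exists a : A, val z = f a >] : bool).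
Proof.
split=> [|a u v /asboolP[x ux] /asboolP[y vy]]; apply/asboolP.
  by exists 0; rewrite !linear0.
by exists (a *: x + y); rewrite [RHS]linearP -ux -vy [LHS]linearP.
Qed.

Lemma kermodP V W (f : {linear V -> W}) (z : kermod f) : f (val z) = 0.
Proof. by apply/eqP; apply: (valP z). Qed.

Lemma kermod_ex V W (f : {linear V -> W}) x : f x = 0 ->
  exists z : kermod f, val z = x.
Proof. by move=> /eqP fx; exists (KerMod fx). Qed.

Lemma zero_mod_homology A B C (f : {linear A -> B}) (g : {linear B -> C}) :
  zero_mod (homology f g) <-> forall b, g b = 0 -> exists a, b = f a.
Proof.
rewrite zero_mod_modquot; split=> [h b /kermod_ex[z <-]|h z].
  move: (h z); rewrite (submod_closed_span (homology_image_closed f g)).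
  by move=> /asboolP.
by apply: mem_span; apply/asboolP; apply: h; apply: kermodP.
Qed.

Lemma lift_kermod U V W (f : {linear U -> V}) (g : {linear V -> W}) :
  (forall x, g (f x) = 0) ->
  exists h : {linear U -> kermod g}, forall x, val (h x) = f x.
Proof.
move=> gf; have [|x|h hE] := lift_inj (f := f) (i := val : {linear kermod g -> V}).
- exact: val_inj.
- by have [z zE] := kermod_ex (gf x); exists z; exact: esym zE.
- by exists h => x; exact: esym (hE x).
Qed.

Lemma short_exact_ker V W (f : {linear V -> W}) :
  (forall y, exists x, y = f x) -> short_exact (val : {linear kermod f -> V}) f.
Proof.
move=> fs; split; [exact: val_inj | move=> b | exact: fs].
by split=> [/kermod_ex[z <-]|[z ->]]; [exists z | apply: kermodP].
Qed.

Lemma short_exact_coker V W (f : {linear V -> W}) : injective f ->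
  exists (C : lmodType R) (p : {linear W -> C}), short_exact f p.
Proof.
move=> fi.
exists (modquot (fun y : W => `[< exists x, y = f x >])), (mqpi _).
split; [exact: fi | move=> b | exact: mqpi_surj].
rewrite mqpi_eq0 (submod_closed_span (image_submod_closed f)).
by split=> [/asboolP|?]; last apply/asboolP.
Qed.

Definition row_map V n (v : 'I_n -> V) (x : 'rV[R]_n) : V :=
  \sum_i x 0 i *: v i.
Fact row_map_is_linear V n (v : 'I_n -> V) : linear (row_map v).
Proof.
move=> a x y; rewrite /row_map scaler_sumr -big_split; apply: eq_bigr => i _.
by rewrite !mxE scalerDl scalerA.
Qed.
HB.instance Definition _ V n (v : 'I_n -> V) :=
  GRing.isLinear.Build R 'rV[R]_n V *:%R (row_map v) (row_map_is_linear v).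

Lemma row_map_delta V n (v : 'I_n -> V) i : row_map v (delta_mx 0 i) = v i.
Proof.
rewrite /row_map (bigD1 i) //= big1 => [|j ji]; rewrite mxE ?eqxx ?scale1r ?addr0 //.
by rewrite (negPf ji) andbF scale0r.
Qed.

Lemma row_mapE V n (f : {linear 'rV[R]_n -> V}) x :
  f x = row_map (fun i => f (delta_mx 0 i)) x.
Proof.
rewrite {1}[x]row_sum_delta linear_sum; apply: eq_bigr => i _.
by rewrite linearZ.
Qed.

Lemma row_lift A B n (p : {linear A -> B}) (u : {linear 'rV[R]_n -> B}) :
  (forall b, exists a, b = p a) ->
  exists v : {linear 'rV[R]_n -> A}, forall x, u x = p (v x).
Proof.
move=> /choice[s ps].
exists (row_map (fun i => s (u (delta_mx 0 i)))) => x.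
rewrite [LHS]row_mapE linear_sum; apply: eq_bigr => i _.
by rewrite linearZ -ps.
Qed.

Lemma projective_row n : projective ('rV[R]_n).
Proof. by move=> A B p u; apply: row_lift. Qed.

Lemma span_seqP V (s : seq V) x :
  x \in span (mem s) -> exists y : 'rV[R]_(size s), x = row_map (fun i => s`_i) y.
Proof.
move/(span_min (image_submod_closed (row_map (fun i : 'I_(size s) => s`_i)))).
move=> h; apply/asboolP; apply: h => z zs; apply/asboolP.
have zi : (index z s < size s)%N by rewrite index_mem.
by exists (delta_mx 0 (Ordinal zi)); rewrite [RHS]row_map_delta /= nth_index.
Qed.

Lemma fin_genP V : fin_gen V <->
  exists n (f : {linear 'rV[R]_n -> V}), forall v, exists x, v = f x.
Proof.
split=> [[s hs]|[n [f fs]]].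
  by exists (size s), (row_map (fun i => s`_i)) => v; apply: span_seqP.
exists [seq f (delta_mx 0 i) | i : 'I_n] => v.
have [x ->] := fs v; rewrite row_mapE; apply: rpred_sum => i _.
by apply: rpredZ; apply: mem_span; apply: map_f; rewrite mem_enum.
Qed.

Lemma fin_gen_surj V W (f : {linear V -> W}) :
  (forall y, exists x, y = f x) -> fin_gen V -> fin_gen W.
Proof.
move=> fs /fin_genP[n [g gs]]; apply/fin_genP; exists n, (f \o g) => w.
by have [v ->] := fs w; have [x ->] := gs v; exists x.
Qed.

Lemma fin_gen_row n : fin_gen ('rV[R]_n).
Proof. by apply/fin_genP; exists n, idfun => v; exists v. Qed.

End Exact.

(** * Augmented complexes and the comparison theorem *)

Section Aug.
Variable R : comNzRingType.
Implicit Types M N : lmodType R.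

(* M placed in degree 0 and X shifted by one: the augmentation becomes a
   differential like the others. *)
Definition aterm M (X : augmented M) (n : nat) : lmodType R :=
  if n is n'.+1 then X n' else M.
Definition adiff M (X : augmented M) (n : nat) :
    {linear aterm X n.+1 -> aterm X n} :=
  match n with 0 => aug X | n'.+1 => cdiff X n' end.

Lemma adiffK M (X : augmented M) n x : adiff X n (adiff X n.+1 x) = 0.
Proof. by case: n x => [|n] x; [apply: aug_diff | apply: cdiffK]. Qed.

Lemma hom_aug_exactP M (X : augmented M) (H : lmodType R) : hom_aug_exact H X <->
  (forall u : {linear H -> M}, exists v : {linear H -> X 0%N}, forall h, u h = aug X (v h)) /\
  forall n (u : {linear H -> aterm X n.+1}), (forall h, adiff X n (u h) = 0) ->
    exists v : {linear H -> aterm X n.+2}, forall h, u h = adiff X n.+1 (v h).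
Proof.
split=> [[h1 h2 h3]|[h1 h2]]; first by split=> // -[|n] u; [apply: h2 | apply: h1].
by split=> // [n|]; [apply: (h2 n.+1) | apply: (h2 0%N)].
Qed.

Lemma aug_exactP M (X : augmented M) : aug_exact X <->
  (forall x : M, exists y, x = aug X y) /\
  forall n (x : aterm X n.+1), adiff X n x = 0 -> exists y, x = adiff X n.+1 y.
Proof.
split=> [[h1 h2 h3]|[h1 h2]]; first by split=> // -[|n] u; [apply: h2 | apply: h1].
by split=> // [n|]; [apply: (h2 n.+1) | apply: (h2 0%N)].
Qed.

Lemma projective_hom_aug_exact M (X : augmented M) (H : lmodType R) :
  projective H -> aug_exact X -> hom_aug_exact H X.
Proof.
move=> Hp /aug_exactP[Xs Xe]; apply/hom_aug_exactP.
split=> [u|n u uk]; first exact: Hp.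
have [w wE] := lift_kermod uk.
have [q qE] := lift_kermod (@adiffK M X n).
have [z|v vE] := Hp _ _ q w.
  have [y yE] := Xe n (val z) (kermodP z); exists y.
  by apply: val_inj; rewrite qE.
by exists v => h; rewrite -wE vE qE.
Qed.

Section Comparison.
Variables (P : lmodType R -> Prop) (M N : lmodType R).
Variables (X : augmented M) (Y : augmented N).
Hypothesis XP : forall n, P (X n).
Hypothesis YP : forall H, P H -> hom_aug_exact H Y.

(** Exactness of Hom(H, Y) for H among the terms of X takes the place of projectivity, so the same
    lemma serves projective resolutions and proper G-resolutions. *)
Lemma comparison (phi : {linear M -> N}) :
  exists f : forall n, {linear aterm X n -> aterm Y n},
    (forall x, f 0%N x = phi x) /\
    forall n x, adiff Y n (f n.+1 x) = f n (adiff X n x).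
Proof.
(* That one further map exists is part of the state, so that every choice can be continued. *)
pose inv n (f : {linear aterm X n -> aterm Y n}) :=
  exists f' : {linear aterm X n.+1 -> aterm Y n.+1},
    forall x, adiff Y n (f' x) = f (adiff X n x).
pose T n := {f : {linear aterm X n -> aterm Y n} | inv n f}.
pose E n (f : T n) (f' : T n.+1) :=
  forall x, adiff Y n (sval f' x) = sval f (adiff X n x).
have inv0 : inv 0%N phi.
  have /hom_aug_exactP[/(_ (phi \o aug X))[v vE] _] := YP (XP 0).
  by exists v => x; rewrite /= -vE.
have next n (f : T n) : exists f', E n f f'.
  case: f => f [f' fE]; rewrite /E /=.
  suff invf' : inv n.+1 f' by exists (exist _ f' invf').
  have /hom_aug_exactP[_ /(_ n (f' \o adiff X n.+1))[]] := YP (XP n.+1).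
    by move=> h /=; rewrite fE adiffK linear0.
  by move=> v vE; exists v => x; rewrite -vE.
have [s s0 sE] := @dependent_choice_rel T E (exist _ phi inv0) next.
by exists (fun n => sval (s n)); split=> [x|n]; [rewrite s0 | apply: sE].
Qed.

Lemma null_homotopy (f : forall n, {linear aterm X n -> aterm Y n}) :
  (forall x, f 0%N x = 0) ->
  (forall n x, adiff Y n (f n.+1 x) = f n (adiff X n x)) ->
  exists2 h : forall n, {linear aterm X n -> aterm Y n.+1},
    forall x, h 0%N x = 0 &
    forall n x, f n.+1 x = adiff Y n.+1 (h n.+1 x) + h n (adiff X n x).
Proof.
move=> f0 fE.
(* What remains of f after subtracting h d is a cycle; lifting it through Y yields the next h. *)
pose inv n (h : {linear aterm X n -> aterm Y n.+1}) :=
  forall x, adiff Y n (f n.+1 x - h (adiff X n x)) = 0.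
pose T n := {h : {linear aterm X n -> aterm Y n.+1} | inv n h}.
pose E n (h : T n) (h' : T n.+1) :=
  forall x, f n.+1 x = adiff Y n.+1 (sval h' x) + sval h (adiff X n x).
pose z : {linear aterm X 0 -> aterm Y 1} := \0.
have inv0 : inv 0%N z by move=> x; rewrite /= subr0 fE f0.
have next n (h : T n) : exists h', E n h h'.
  case: h => h hinv; rewrite /E /=.
  pose u : {linear aterm X n.+1 -> aterm Y n.+1} := f n.+1 \- (h \o adiff X n).
  have /hom_aug_exactP[_ /(_ n u hinv)[h' h'E]] := YP (XP n).
  have inv' : inv n.+1 h'.
    by move=> x; rewrite linearB fE -h'E /u /= adiffK linear0 subr0 subrr.
  by exists (exist _ h' inv') => x; rewrite /= -h'E /u /= subrK.
have [s s0 sE] := @dependent_choice_rel T E (exist _ z inv0) next.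
by exists (fun n => sval (s n)) => //; rewrite s0.
Qed.

End Comparison.

(** When X is a projective resolution of M, this says Ext^(n+1)(M, N) = 0. *)
Definition cocycles_bound M (X : augmented M) N n : Prop :=
  forall u : {linear X n.+1 -> N}, (forall x, u (cdiff X n.+1 x) = 0) ->
    exists v : {linear X n -> N}, forall x, u x = v (cdiff X n x).

Lemma zero_mod_cohomology M (X : augmented M) N n :
  zero_mod (cohomology X N n.+1) <-> cocycles_bound X N n.
Proof.
rewrite zero_mod_homology; split=> [h u u0|h b b0].
  have /h[v vE] : hom_map N (cdiff X n.+1) (to_hom u) = 0.
    by apply/val_inj/funext => x; apply: u0.
  by exists v => x; move/(congr1 (fun w : hom _ _ => w x)): vE.
have [x|v vE] := h b; first by move/(congr1 (fun w : hom _ _ => w x)): b0.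
by exists (to_hom v); apply/val_inj/funext.
Qed.

Lemma cocycles_bound_indep M (X Y : augmented M) N n :
  resolution (@projective R) X -> resolution (@projective R) Y ->
  cocycles_bound X N n -> cocycles_bound Y N n.
Proof.
move=> [Xp Xe] [Yp Ye] hX.
have XP H (Hp : projective H) := projective_hom_aug_exact Hp Xe.
have YP H (Hp : projective H) := projective_hom_aug_exact Hp Ye.
have [f [f0 fE]] := comparison Xp YP idfun.
have [g [g0 gE]] := comparison Yp XP idfun.
pose e k : {linear aterm Y k -> aterm Y k} := (f k \o g k) \- idfun.
have e0 x : e 0%N x = 0 by rewrite /e /= f0 g0 /= subrr.
have eE k x : adiff Y k (e k.+1 x) = e k (adiff Y k x).
  by rewrite /e /= linearB fE gE.
have [h _ hE] := null_homotopy Yp YP e0 eE.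
move=> u u0; have [x|v vE] := hX (u \o f n.+2).
  by rewrite /=; have /= <- := fE n.+2 x; apply: u0.
(* Since u kills boundaries, the homotopy gives u f g - u = u h d, while u f = v d. *)
exists ((v \o g n.+1) \- (u \o h n.+1)) => x /=.
have /= -> := esym (gE n.+1 x); have /= <- := vE (g n.+2 x).
have /= := congr1 u (hE n.+1 x); rewrite linearB linearD u0 add0r => <-.
by rewrite opprB addrC subrK.
Qed.

Lemma ext_zero_cocycles M N n (X : augmented M) :
  resolution (@projective R) X -> ext_zero M N n.+1 <-> cocycles_bound X N n.
Proof.
move=> hX; split=> [[Y hY /zero_mod_cohomology]|h]; first exact: cocycles_bound_indep.
by exists X => //; apply/zero_mod_cohomology.
Qed.

Section Splice.
Variables (K G M : lmodType R) (i : {linear K -> G}) (p : {linear G -> M}).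
Hypothesis ip : short_exact i p.
Variable X : augmented K.

Definition splice_term n : lmodType R := if n is n'.+1 then X n' else G.
Definition splice_diff n : {linear splice_term n.+1 -> splice_term n} :=
  match n with 0 => i \o aug X | n'.+1 => cdiff X n' end.
Fact splice_diffK n x : splice_diff n (splice_diff n.+1 x) = 0.
Proof.
by case: n x => [|n] x /=; [rewrite aug_diff linear0 | apply: cdiffK].
Qed.
Fact splice_aug_diff (x : splice_term 1) : p (splice_diff 0 x) = 0.
Proof. by case: ip => _ h _; apply/h; eexists. Qed.
Definition splice : augmented M :=
  @Augmented _ _ (Complex splice_diffK) p splice_aug_diff.

Lemma splice_exact : aug_exact X -> aug_exact splice.
Proof.
case: ip => ii ex ps /aug_exactP[Xs Xe]; apply/aug_exactP; split=> // -[|[|n]] x.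
- by move=> /ex[a ->]; have [y ->] := Xs a; exists y.
- by move=> h; apply: (Xe 0%N x); apply: ii; rewrite linear0.
- exact: (Xe n.+1 x).
Qed.

Lemma splice_hom_exact H : hom_aug_exact H X ->
  (forall u : {linear H -> M}, exists v : {linear H -> G}, forall h, u h = p (v h)) ->
  hom_aug_exact H splice.
Proof.
case: ip => ii ex ps /hom_aug_exactP[Xs Xe] hH.
apply/hom_aug_exactP; split=> // -[|[|n]] u.
- move=> u0; have [h|w wE] := lift_inj (f := u) ii; first by apply/ex.
  have [v vE] := Xs w; exists v => h; by rewrite wE vE.
- by move=> h; apply: (Xe 0%N u) => x; apply: ii; rewrite linear0 -[RHS](h x).
- exact: (Xe n.+1 u).
Qed.

Lemma splice_resolution (P : lmodType R -> Prop) :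
  P G -> resolution P X -> resolution P splice.
Proof. by move=> GP [XP Xe]; split; [case | apply: splice_exact]. Qed.

End Splice.

Section Shift.
Variables (M : lmodType R) (X : augmented M).

Definition shift_aug := projT1 (cid (lift_kermod (@aug_diff _ _ X))).
Lemma shift_augE x : val (shift_aug x) = cdiff X 0%N x.
Proof. by rewrite /shift_aug; case: cid => a /=. Qed.
Definition shift_complex : complex R :=
  @Complex R (fun n => X n.+1) (fun n => cdiff X n.+1) (fun n => @cdiffK _ X n.+1).
Fact shift_aug_diff (x : shift_complex 1%N) : shift_aug (cdiff shift_complex 0%N x) = 0.
Proof. by apply: val_inj; rewrite shift_augE; apply: cdiffK. Qed.
Definition shift : augmented (kermod (aug X)) :=
  @Augmented _ _ shift_complex shift_aug shift_aug_diff.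

Lemma shift_exact : aug_exact X -> aug_exact shift.
Proof.
move=> /aug_exactP[Xs Xe]; apply/aug_exactP; split=> [z|[|n] x h].
- have [y yE] := Xe 0%N (val z) (kermodP z); exists y.
  by apply: val_inj; rewrite yE; apply/esym/shift_augE.
- apply: (Xe 1%N x); move/(congr1 val): h.
  by rewrite [LHS]shift_augE => ->; rewrite linear0.
- exact: (Xe n.+2 x).
Qed.
End Shift.

(* Ext^1(G, N) = 0, without a choice of projective resolution. *)
Definition ext1 (G N : lmodType R) : Prop :=
  forall (A B : lmodType R) (i : {linear A -> B}) (p : {linear B -> G}), short_exact i p ->
    forall u : {linear A -> N}, exists v : {linear B -> N}, forall x, u x = v (i x).

(** All syzygies are kept in T. The vanishing of Ext is part of the conclusion because a cocycle
    factors through a syzygy, and X alone no longer shows that this syzygy and the next one lie in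
    T. *)
Lemma class_resolution (T Q : lmodType R -> Prop) :
  (forall G, T G -> exists (Z P : lmodType R) (i : {linear Z -> P}) (p : {linear P -> G}),
     [/\ short_exact i p, T Z & Q P]) ->
  forall M, T M -> exists2 X : augmented M, resolution Q X &
    forall N, (forall G, T G -> ext1 G N) -> forall n, cocycles_bound X N n.
Proof.
move=> hT M TM.
pose E (_ : nat) (G Z : {G | T G}) :=
  exists (P : lmodType R) (i : {linear sval Z -> P}) (p : {linear P -> sval G}), short_exact i p /\ Q P.
have next n (G : {G | T G}) : exists Z, E n G Z.
  case: G => G TG; have [Z [P [i [p [ip TZ QP]]]]] := hT G TG.
  by exists (exist _ Z TZ), P, i, p.
have [s s0 sE] := @dependent_choice_rel (fun=> {G | T G}) E (exist _ M TM) next.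
suff: exists2 X : augmented (sval (s 0%N)), resolution Q X &
    forall N, (forall G, T G -> ext1 G N) -> forall n, cocycles_bound X N n.
  by rewrite s0.
have s1 n := cid (sE n).
pose P n : lmodType R := projT1 (s1 n).
have s2 n := cid (projT2 (s1 n)).
pose i n : {linear sval (s n.+1) -> P n} := projT1 (s2 n).
have s3 n := cid (projT2 (s2 n)).
pose p n : {linear P n -> sval (s n)} := projT1 (s3 n).
have ip n : short_exact (i n) (p n) by case: (projT2 (s3 n)).
have QP n : Q (P n) by case: (projT2 (s3 n)).
have piE n x : p n (i n x) = 0 by case: (ip n) => _ h _; apply/h; exists x.
pose d n : {linear P n.+1 -> P n} := i n \o p n.+1.
have dK n x : d n (d n.+1 x) = 0 by rewrite /d /= piE linear0.
have d0 (x : Complex dK 1%N) : p 0%N (d 0%N x) = 0 by rewrite /d /= piE.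
exists (Augmented d0).
  split=> //; apply/aug_exactP; split=> [x|n x xE].
    by have [_ _ /(_ x)] := ip 0%N.
  have pE : p n x = 0.
    by case: n x xE => [//|n] x xE; have [ii _ _] := ip n; apply: ii; rewrite linear0.
  have [_ /(_ x)[/(_ pE)[y yE] _] _] := ip n.
  by have [_ _ /(_ y)[z zE]] := ip n.+1; exists z; rewrite /= yE zE.
move=> N hN n u u0.
have [_ ex ps] := ip n.+1.
have [|w wE] := factor_surj (f := u) ps.
  by move=> x /ex[y ->]; have [_ _ /(_ y)[z ->]] := ip n.+2; apply: u0.
have [v vE] := hN _ (svalP (s n)) _ _ _ _ (ip n) w.
by exists v => x; rewrite wE vE.
Qed.

End Aug.

(** * Noetherian rings and vanishing of Ext *)

Section Noeth.
Variable R : comNzRingType.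

Lemma fin_gen_extension (V W : lmodType R) (f : {linear V -> W}) n
    (u : {linear 'rV[R]_n -> V}) :
  fin_gen (kermod f) -> (forall v, exists y, f v = f (u y)) -> fin_gen V.
Proof.
move=> /fin_genP[k [w ws]] hu; apply/fin_genP; exists (k + n)%N.
pose g (x : 'rV[R]_(k + n)) : V := val (w (lsubmx x)) + u (rsubmx x).
have gL : linear g.
  by move=> a x y; rewrite /g !linearP /= scalerDr addrACA.
exists (mklin gL) => v; have [y yE] := hu v.
have /kermod_ex[z zE] : f (v - u y) = 0 by rewrite linearB yE subrr.
have [x xE] := ws z; exists (row_mx x y).
by rewrite /= /mklin_fun /g row_mxKl row_mxKr -xE zE subrK.
Qed.

Hypothesis Rn : noetherian R.

(** The first coordinates form a finitely generated ideal, and the elements with first coordinate 0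
    embed in R^(n-1). *)
Lemma fin_gen_sub_row n (V : lmodType R) (f : {linear V -> 'rV[R]_n}) :
  injective f -> fin_gen V.
Proof.
elim: n V f => [|n IH] V f fi.
  apply/fin_genP; exists 0%N, \0 => v; exists 0.
  by apply: fi; apply/rowP => -[].
pose c (v : V) : R^o := f v 0 0.
have cL : linear c by move=> a x y; rewrite /c linearP !mxE.
have cI := image_submod_closed (mklin cL).
have [s sE] := Rn cI.
have /choice[t tE] : forall j : 'I_(size s), exists v, s`_j = c v.
  move=> j; have : s`_j \in span (mem s) by apply: mem_span; apply: mem_nth.
  by rewrite -sE => /asboolP.
apply: (fin_gen_extension (f := mklin cL) (u := row_map t)).
  pose g (z : kermod (mklin cL)) : 'rV[R]_n := rsubmx (f (val z) : 'rV_(1 + n)).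
  have gL : linear g by move=> a x y; rewrite /g !linearP.
  apply: (IH _ (mklin gL)); apply: linear_injP => z z0.
  apply: val_inj; rewrite linear0; apply: fi; rewrite linear0.
  rewrite -[f _](@hsubmxK _ 1 1 n) -[rsubmx _]/(mklin gL z) z0.
  have -> : lsubmx (f (val z) : 'rV_(1 + n)) = 0; last by rewrite row_mx0.
  apply/rowP => j; rewrite !mxE ord1.
  by have := kermodP z; rewrite /= /mklin_fun /c => <-; congr (f _ _ _); apply/val_inj.
move=> v; have : c v \in span (mem s).
  by rewrite -sE; apply/asboolP; exists v.
move=> /span_seqP[y yE]; exists y; rewrite /= [LHS]yE.
by rewrite [RHS]linear_sum; apply: eq_bigr => i _; rewrite linearZ [RHS]/= tE.
Qed.

Lemma fin_gen_sub (V W : lmodType R) (f : {linear V -> W}) :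
  injective f -> fin_gen W -> fin_gen V.
Proof.
move=> fi /fin_genP[n [g gs]].
(* The kernel of d is the fibre product of R^n and V over W: it projects onto V, and embeds in R^n
   since f is injective. *)
pose d (x : 'rV[R]_n * V) : W := g x.1 - f x.2.
have dL : linear d by move=> a x y; rewrite /d !linearP /= scalerDr addrACA.
pose q (z : kermod (mklin dL)) : V := (val z).2.
have qL : linear q by [].
apply: (@fin_gen_surj R _ _ (mklin qL)) => [v|].
  have [x xE] := gs (f v).
  have /kermod_ex[z zE] : mklin dL (x, v) = 0 by rewrite /= /mklin_fun /d /= xE subrr.
  by exists z; rewrite /= /mklin_fun /q zE.
pose r (z : kermod (mklin dL)) : 'rV[R]_n := (val z).1.
have rL : linear r by [].
apply: (@fin_gen_sub_row n _ (mklin rL)); apply: linear_injP => z z0.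
have := kermodP z; rewrite /= /mklin_fun /d -/(r z) [r z]z0 linear0 sub0r => /eqP.
rewrite oppr_eq0 => /eqP h.
apply: val_inj; rewrite linear0 [val z]surjective_pairing -/(r z) [r z]z0.
by congr (_, _); apply: fi; rewrite h linear0.
Qed.

Definition free_row (P : lmodType R) : Prop := exists n, P = 'rV[R]_n.

Lemma free_row_projective P : free_row P -> projective P.
Proof. by case=> n ->; apply: projective_row. Qed.

Lemma fin_gen_syzygy (M : lmodType R) : fin_gen M ->
  exists n (Z : lmodType R) (i : {linear Z -> 'rV[R]_n}) (p : {linear 'rV[R]_n -> M}),
    short_exact i p /\ fin_gen Z.
Proof.
move=> /fin_genP[n [f fs]]; exists n, (kermod f), val, f.
split; first exact: short_exact_ker.
by apply: (@fin_gen_sub_row n _ val); apply: val_inj.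
Qed.

Lemma fin_gen_resolution (M : lmodType R) : fin_gen M ->
  exists X : augmented M, resolution free_row X.
Proof.
move=> fM; have [|X Xr _] := @class_resolution R (@fin_gen R) free_row _ M fM.
  move=> G /fin_gen_syzygy[n [Z [i [p [ip fZ]]]]].
  by exists Z, 'rV[R]_n, i, p; split=> //; exists n.
by exists X.
Qed.
End Noeth.

(** * The first Ext module as an obstruction to extending and lifting maps *)

Section Ext1.
Variable R : comNzRingType.
Implicit Types A B C G N P Z : lmodType R.

Lemma resolution_free_projective M (X : augmented M) :
  resolution (@free_row R) X -> resolution (@projective R) X.
Proof. by case=> h e; split=> // n; apply: free_row_projective. Qed.

Lemma ext1_presentation Z P G N (i : {linear Z -> P}) (p : {linear P -> G}) :
  short_exact i p -> projective P ->
  (forall u : {linear Z -> N}, exists v : {linear P -> N}, forall x, u x = v (i x)) ->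
  ext1 G N.
Proof.
move=> [ii ex ps] Pp hu A B j q [ji jex js] u.
have [f fE] := Pp _ _ q p js.
have [g gE] : exists g : {linear Z -> A}, forall z, f (i z) = j (g z).
  apply: (lift_inj (f := f \o i)) => // z; apply/jex; rewrite -fE.
  by apply/ex; exists z.
have [v vE] := hu (u \o g).
(* B is the pushout of A and P along Z, so u and v glue to a map on B once they agree on Z. *)
pose d (x : A * P) : B := j x.1 + f x.2.
have dL : linear d by move=> a x y; rewrite /d /= !linearP scalerDr addrACA.
pose t (x : A * P) : N := u x.1 + v x.2.
have tL : linear t by move=> a x y; rewrite /t /= !linearP scalerDr addrACA.
have [b|x x0|w wE] := factor_surj (p := mklin dL) (f := mklin tL).
- have [x xE] := ps (q b).
  have /jex[a aE] : q (b - f x) = 0 by rewrite linearB -fE -xE subrr.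
  by exists (a, x); rewrite /= /mklin_fun /d /= -aE subrK.
- have x0' : j x.1 + f x.2 = 0 by [].
  have /ex[z zE] : p x.2 = 0.
    move/(congr1 q): x0'; rewrite linearD linear0 -fE.
    by have /jex -> : exists a, j x.1 = j a; [exists x.1 | rewrite add0r].
  have aE : x.1 = - g z.
    apply: ji; rewrite linearN -gE -zE; apply/eqP.
    by rewrite -subr_eq0 opprK x0'.
  by rewrite /= /mklin_fun /t aE zE linearN -vE /= addNr.
by exists w => a; have := wE (a, 0); rewrite /= /mklin_fun /t /d /= !linear0 !addr0.
Qed.

Lemma ext_zero_ext1 G N : ext_zero G N 1 -> ext1 G N.
Proof.
move=> [X [Xp Xe] /zero_mod_cohomology hX].
have /aug_exactP[Xs _] := Xe.
apply: (ext1_presentation (short_exact_ker Xs) (Xp 0%N)) => u.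
have [x|v vE] := hX (u \o shift_aug X).
  by rewrite /= [shift_aug _ _](@aug_diff _ _ (shift X) x) linear0.
exists v => z; have /aug_exactP[/(_ z)[y ->] _] := shift_exact Xe.
by rewrite [LHS]vE /= shift_augE.
Qed.

Lemma ext1_lift H A B C (i : {linear A -> B}) (p : {linear B -> C}) :
  short_exact i p -> ext1 H A ->
  forall u : {linear H -> C}, exists v : {linear H -> B}, forall h, u h = p (v h).
Proof.
move=> [ii ex ps] hH u.
(* The kernel D of d is the pullback of the extension along u, an extension of H by A. It splits by
   [hH], and a splitting amounts to a lift of u. *)
pose d (x : H * B) : C := u x.1 - p x.2.
have dL : linear d by move=> a x y; rewrite /d /= !linearP scalerDr addrACA.
pose D : lmodType R := kermod (mklin dL).
have DP (z : D) : u (val z).1 = p (val z).2.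
  by have := kermodP z; rewrite /= /mklin_fun /d => /eqP; rewrite subr_eq0 => /eqP.
pose q1 (z : D) : H := (val z).1.
pose q2 (z : D) : B := (val z).2.
have q1L : linear q1 by [].
have q2L : linear q2 by [].
have [j jE] : exists j : {linear A -> D}, forall a, (0, i a) = val (j a).
  have tL : linear (fun a : A => (0 : H, i a)).
    move=> a x y; rewrite linearP; apply: injective_projections => //=.
    by rewrite scaler0 addr0.
  have [a|j jE] := lift_kermod (f := mklin tL) (g := mklin dL).
    rewrite /= /mklin_fun /d /= linear0 sub0r; apply/eqP; rewrite oppr_eq0.
    by apply/eqP/ex; exists a.
  by exists j => a; rewrite jE.
have es : short_exact j (mklin q1L).
  split=> [a b ab|z|h].
  - by apply: ii; have := congr1 snd (jE a); rewrite ab -jE.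
  - split=> [z0|[a ->]]; last by rewrite /= /mklin_fun /q1 -jE.
    have /ex[a aE] : p (val z).2 = 0 by rewrite -DP -/(q1 z) [q1 z]z0 linear0.
    exists a; apply: val_inj; rewrite -jE [LHS]surjective_pairing aE.
    by rewrite -/(q1 z) [q1 z]z0.
  - have [b bE] := ps (u h).
    have /kermod_ex[z zE] : mklin dL (h, b) = 0 by rewrite /= /mklin_fun /d /= bE subrr.
    by exists z; rewrite /= /mklin_fun /q1 zE.
have [r rE] := hH _ _ _ _ es idfun.
pose k : {linear D -> B} := mklin q2L \- (i \o r).
have [|z z0|v vE] := factor_surj (p := mklin q1L) (f := k).
- by case: es.
- case: es => _ /(_ z)[/(_ z0)[a ->] _] _.
  by rewrite /k /= -rE /= /mklin_fun /q2 -jE /= subrr.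
exists v => h; case: es => _ _ /(_ h)[z ->].
rewrite -vE /k /= linearB /mklin_fun /q1 /q2 DP.
by have /ex -> : exists a, i (r z) = i a; [exists (r z) | rewrite subr0].
Qed.

Lemma ext1_projective P N : projective P -> ext1 P N.
Proof.
move=> Pp A B i p [ii ex ps] u.
have [s sE] := Pp _ _ p idfun ps.
have [b|r rE] := lift_inj (f := idfun \- (s \o p)) ii.
  by apply/ex; rewrite /= linearB -sE /= subrr.
exists (u \o r) => a /=; congr (u _); apply: ii; rewrite -rE /=.
by have /ex -> : exists a', i a = i a'; [exists a | rewrite linear0 subr0].
Qed.

Lemma ext1_row G n : ext1 G R^o -> ext1 G 'rV[R]_n.
Proof.
move=> hG A B i p ip u.
have cL (j : 'I_n) : linear (fun x : A => u x 0 j : R^o).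
  by move=> a x y; rewrite linearP !mxE.
have /choice[v vE] j := hG _ _ _ _ ip (mklin (cL j)).
pose w (x : B) : 'rV[R]_n := \row_j (v j x : R).
have wL : linear w by move=> a x y; apply/rowP => j; rewrite !mxE linearP.
by exists (mklin wL) => x; apply/rowP => j; rewrite !mxE -vE.
Qed.

End Ext1.

(** * Totally reflexive modules *)

Section Reflexive.
Variable R : comNzRingType.
Implicit Types A B C G N P Z F : lmodType R.

Definition dmap A B (f : {linear A -> B}) : {linear dual B -> dual A} :=
  hom_map R^o f.

Lemma hom_inj A N (u v : hom A N) : (forall x, u x = v x) -> u = v.
Proof. by move=> uv; apply/val_inj/funext. Qed.

Lemma short_exact_dual A B C (i : {linear A -> B}) (p : {linear B -> C}) :
  short_exact i p -> ext1 C R^o -> short_exact (dmap p) (dmap i).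
Proof.
move=> ip hC; have [ii ex ps] := ip; split=> [u v uv|v|u].
- apply: hom_inj => c; have [b ->] := ps c.
  exact: (congr1 (fun w : hom _ _ => w b) uv).
- split=> [v0|[w ->]]; last first.
    apply: hom_inj => a /=; rewrite (_ : p (i a) = 0) ?linear0 //.
    by apply/ex; exists a.
  have [x /ex[a ->]|w wE] := factor_surj (f := v : {linear B -> R^o}) ps.
    exact: (congr1 (fun w : hom _ _ => w a) v0).
  by exists (to_hom w); apply: hom_inj => x; rewrite wE.
- have [v vE] := hC _ _ _ _ ip u.
  by exists (to_hom v); apply: hom_inj => x; rewrite vE.
Qed.

Lemma dual_row n : exists2 e : {linear 'rV[R]_n -> dual 'rV[R]_n}, bijective e &
  forall x y, (e x : hom _ _) y = \sum_j x 0 j * y 0 j.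
Proof.
pose f (x : 'rV[R]_n) (y : 'rV[R]_n) : R^o := \sum_j x 0 j * y 0 j.
have fL x : linear (f x).
  move=> a y z; rewrite /f scaler_sumr -big_split; apply: eq_bigr => j _ /=.
  by rewrite !mxE mulrDr [a *: _]mulrCA.
pose e x : dual 'rV[R]_n := to_hom (mklin (fL x)).
have eL : linear e.
  move=> a y z; apply: hom_inj => x; rewrite [RHS]/= /= /mklin_fun /f.
  rewrite -[RHS]/(a * (f y x) + f z x) /f mulr_sumr -big_split; apply: eq_bigr => j _ /=.
  by rewrite !mxE mulrDl mulrA.
have fdelta x j : f x (delta_mx 0 j) = x 0 j.
  rewrite /f (bigD1 j) //= big1 ?addr0 => [|k kj]; first by rewrite mxE !eqxx mulr1.
  by rewrite mxE (negPf kj) andbF mulr0.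
exists (mklin eL) => //; apply: linear_bijP => [x y xy|u].
  apply/rowP => j; rewrite -!fdelta.
  exact: (congr1 (fun w : hom _ _ => w (delta_mx 0 j)) xy).
exists (\row_j (u : hom _ _) (delta_mx 0 j)); apply: hom_inj => x.
rewrite [LHS](row_mapE (u : {linear _ -> _})) /row_map /= /mklin_fun /f.
by apply: eq_bigr => j _; rewrite mxE mulrC.
Qed.

Lemma bidual_row n (Xi : {linear dual 'rV[R]_n -> R^o}) :
  exists x, forall u, Xi u = (u : hom _ _) x.
Proof.
have [e [e' ee' e'e] eE] := dual_row n.
exists (\row_j Xi (e (delta_mx 0 j))) => u; rewrite -[u]e'e eE.
have <- : row_map (fun j => Xi (e (delta_mx 0 j))) (e' u) = Xi (e (e' u)).
  by rewrite [RHS](row_mapE (Xi \o e)).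
by apply: eq_bigr => j _; rewrite mxE.
Qed.

Definition torsionless G := forall x : G, (forall u : dual G, (u : hom _ _) x = 0) -> x = 0.
Definition bidual_onto G := forall Xi : {linear dual G -> R^o},
  exists x : G, forall u : dual G, Xi u = (u : hom _ _) x.

Lemma biduality_is_linear G : linear (@biduality R G).
Proof. by move=> a x y; apply: hom_inj => u; rewrite /= /eval_at linearP. Qed.

Lemma biduality_bijP G : bijective (@biduality R G) <-> torsionless G /\ bidual_onto G.
Proof.
split=> [bG|[tG oG]].
  split=> [x x0|Xi].
    apply: (bij_inj bG); apply: hom_inj => u; rewrite [LHS]x0.
    by rewrite /= [RHS]linear0.
  have [g gK Kg] := bG; exists (g (to_hom Xi)) => u.
  by rewrite -[RHS]/((biduality (g (to_hom Xi)) : hom _ _) u) Kg.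
have bL := @biduality_is_linear G.
have h : bijective (mklin bL); last by case: h => g; exists g.
apply: linear_bijP => [|Xi].
  apply: linear_injP => x x0; apply: tG => u.
  by have := congr1 (fun w : hom _ _ => w u) x0.
have [x xE] := oG (Xi : {linear dual G -> R^o}).
by exists x; apply: hom_inj => u; rewrite xE.
Qed.

Lemma row_torsionless G n (i : {linear G -> 'rV[R]_n}) : injective i -> torsionless G.
Proof.
move=> ii x x0; apply: ii; rewrite linear0; apply/rowP => j; rewrite [RHS]mxE.
have cL : linear (fun y : G => i y 0 j : R^o) by move=> a u v; rewrite linearP !mxE.
exact: (x0 (to_hom (mklin cL))).
Qed.

(** Splicing syzygies on the left and cosyzygies on the right gives complete resolutions inside T.
    So the members are totally reflexive ([class_totally_reflexive]), and only Ext^1 has to be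
    checked, but on all of T. *)
Definition reflexive_class (T : lmodType R -> Prop) : Prop :=
  forall G, T G -> [/\ fin_gen G, ext1 G R^o,
    exists n Z (i : {linear Z -> 'rV[R]_n}) (p : {linear 'rV[R]_n -> G}),
      short_exact i p /\ T Z &
    exists n C (i : {linear G -> 'rV[R]_n}) (p : {linear 'rV[R]_n -> C}),
      short_exact i p /\ T C].

Section Class.
Variable T : lmodType R -> Prop.
Hypothesis hT : reflexive_class T.

Lemma class_torsionless G : T G -> torsionless G.
Proof. by move=> /hT[_ _ _ [n [C [i [p [[ii _ _] _]]]]]]; apply: row_torsionless ii. Qed.

(** Composed with the dual of the embedding of G in R^n, Xi becomes evaluation at some x in R^n. It
    vanishes on functionals coming from C, and C is torsionless, so x lies in G. *)
Lemma class_bidual_onto G : T G -> bidual_onto G.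
Proof.
move=> /hT[_ _ _ [n [C [i [p [ip TC]]]]]] Xi.
have [_ hC _ _] := hT TC; have [_ ex' is'] := short_exact_dual ip hC.
have [x xE] := bidual_row (Xi \o dmap i).
have [_ ex _] := ip; have /ex[g gE] : p x = 0.
  apply: (class_torsionless TC) => c.
  rewrite -[LHS]/((dmap p c : hom _ _) x) -xE /=.
  have /ex' -> : exists a, dmap p c = dmap p a by exists c.
  by rewrite linear0.
by exists g => u; have [v ->] := is' u; rewrite [LHS]xE gE.
Qed.

Lemma class_ext_zero G n : T G -> ext_zero G R^o n.+1.
Proof.
move=> TG; have [|X hX hN] := class_resolution (Q := @projective R) _ TG.
  move=> D /hT[_ _ [k [Z [i [p [ip TZ]]]]] _]; exists Z, 'rV[R]_k, i, p.
  by split=> //; apply: projective_row.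
apply/(ext_zero_cocycles _ _ hX); apply: hN => D /hT[]//.
Qed.

(** Dualizing the cosyzygy sequence presents the dual of G with kernel the dual of C. A functional
    on that kernel is evaluation at some p x, hence extends to R^n as evaluation at x. *)
Lemma class_dual_presentation G : T G ->
  exists n C (i : {linear dual C -> 'rV[R]_n}) (p : {linear 'rV[R]_n -> dual G}),
    [/\ short_exact i p, T C &
     forall u : {linear dual C -> R^o}, exists v : {linear 'rV[R]_n -> R^o},
       forall x, u x = v (i x)].
Proof.
move=> /hT[_ _ _ [n [C [i [p [ip TC]]]]]].
have [_ hC _ _] := hT TC; have [i'i ex is'] := short_exact_dual ip hC.
have [e eb _] := dual_row n; have [e' ee' e'e] := linear_bij_inv eb.
exists n, C, (e' \o dmap p), (dmap i \o e); split=> //.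
  split=> [|x|c].
  - exact: inj_comp (can_inj e'e) i'i.
  - split=> [/ex[a aE]|[a ->]]; first by exists a; rewrite /= -aE ee'.
    by apply/ex; exists a; rewrite /= e'e.
  - by have [b ->] := is' c; exists (e' b); rewrite /= e'e.
move=> u; have [c cE] := class_bidual_onto TC u.
have [_ _ /(_ c)[x xE]] := ip.
have evL : linear (fun y : 'rV[R]_n => (e y : hom _ _) x : R^o).
  by move=> a y z; rewrite linearP.
by exists (mklin evL) => v; rewrite cE /= /mklin_fun e'e xE.
Qed.

(** The duals of members of T are themselves closed under syzygies and have vanishing Ext^1, so
    dimension shifting applies to them. *)
Lemma class_dual_ext_zero G n : T G -> ext_zero (dual G) R^o n.+1.
Proof.
move=> TG; pose T' D := exists2 G, T G & D = dual G.
have TG' : T' (dual G) by exists G.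
have [|X hX hN] := class_resolution (Q := @projective R) _ TG'.
  move=> _ [D /class_dual_presentation[k [C [i [p [ip TC _]]]]] ->].
  exists (dual C), 'rV[R]_k, i, p; split=> //; first by exists C.
  exact: projective_row.
apply/(ext_zero_cocycles _ _ hX); apply: hN => _ [D TD ->].
have [k [C [i [p [ip _ h]]]]] := class_dual_presentation TD.
exact: ext1_presentation ip (@projective_row R k) h.
Qed.

Lemma class_totally_reflexive G : T G -> totally_reflexive G.
Proof.
move=> TG; split; first by case: (hT TG).
  by apply/biduality_bijP; split; [apply: class_torsionless | apply: class_bidual_onto].
by case=> // n _; split; [apply: class_ext_zero | apply: class_dual_ext_zero].
Qed.

End Class.

Lemma ext_zero_shift Z P G N n (i : {linear Z -> P}) (p : {linear P -> G})
    (Y : augmented Z) : short_exact i p -> projective P ->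
  resolution (@projective R) Y -> (ext_zero G N n.+2 <-> ext_zero Z N n.+1).
Proof.
move=> ip Pp hY; rewrite (ext_zero_cocycles _ _ hY).
by rewrite (ext_zero_cocycles _ _ (splice_resolution ip Pp hY)).
Qed.

Lemma ext_zero_one Z P G N (i : {linear Z -> P}) (p : {linear P -> G})
    (Y : augmented Z) : short_exact i p -> projective P ->
  resolution (@projective R) Y ->
  (forall u : {linear Z -> N}, exists v : {linear P -> N}, forall x, u x = v (i x)) ->
  ext_zero G N 1.
Proof.
move=> ip Pp hY hu; apply/(ext_zero_cocycles _ _ (splice_resolution ip Pp hY)).
move=> u u0; have [_ /aug_exactP[Ys Ye]] := hY.
have [x x0|w wE] := factor_surj (p := aug Y) (f := u) Ys.
  by have [y ->] := Ye 0%N x x0; apply: u0.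
by have [v vE] := hu w; exists v => x; rewrite wE vE.
Qed.

Lemma ext_zero_iso G G' N n (e : {linear G -> G'}) : bijective e ->
  ext_zero G N n -> ext_zero G' N n.
Proof.
move=> /linear_bij_inv[e' ee' e'e] [X [Xp /aug_exactP[Xs Xe]] h].
have d0 x : (e \o aug X) (cdiff X 0%N x) = 0 by rewrite /= aug_diff linear0.
exists (Augmented d0) => //; split=> //; apply/aug_exactP; split=> [x|[|k] x].
- by have [y yE] := Xs (e' x); exists y; rewrite /= -yE e'e.
- move=> x0; apply: (Xe 0%N x); apply: (can_inj ee').
  by rewrite linear0 -[RHS]x0.
- exact: (Xe k.+1 x).
Qed.

Section TotallyReflexive.
Hypothesis Rn : noetherian R.
Implicit Type (D : lmodType R).

Lemma totally_reflexive_ext1 G : totally_reflexive G -> ext1 G R^o.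
Proof. by case=> _ _ /(_ 1%N isT)[/ext_zero_ext1]. Qed.

Lemma totally_reflexive_syzygy n Z G (i : {linear Z -> 'rV[R]_n})
    (p : {linear 'rV[R]_n -> G}) :
  short_exact i p -> totally_reflexive G -> totally_reflexive Z.
Proof.
move=> ip hG; have hG1 := totally_reflexive_ext1 hG.
have [ii ex ps] := ip; have [fG bG eG] := hG.
have /biduality_bijP[tG oG] := bG.
have fZ : fin_gen Z by apply: (fin_gen_sub Rn ii); apply: fin_gen_row.
have ipd := short_exact_dual ip hG1; have [pi' ex' is'] := ipd.
have [e eb eE] := dual_row n; have [e' ee' e'e] := linear_bij_inv eb.
(* The dual sequence has the dual of G as a syzygy of the dual of Z, so the higher Ext of the latter
   come from the former by a shift. *)
have ipe : short_exact (e' \o dmap p) (dmap i \o e).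
  split=> [|x|c].
  - exact: inj_comp (can_inj e'e) pi'.
  - split=> [/ex'[a aE]|[a ->]]; first by exists a; rewrite /= -aE ee'.
    by apply/ex'; exists a; rewrite /= e'e.
  - by have [b ->] := is' c; exists (e' b); rewrite /= e'e.
have [Y /resolution_free_projective hY] := fin_gen_resolution Rn fZ.
have [X hX _] : ext_zero (dual G) R^o 1 by case: (eG 1%N).
split=> // [|[//|k] _].
  apply/biduality_bijP; split; first exact: row_torsionless ii.
  move=> Xi; have [x xE] := bidual_row (Xi \o dmap i).
  have /ex[z zE] : p x = 0.
    apply: tG => u; rewrite -[LHS]/((dmap p u : hom _ _) x) -xE /=.
    have /ex' -> : exists a, dmap p u = dmap p a by exists u.
    by rewrite linear0.
  by exists z => u; have [v ->] := is' u; rewrite [LHS]xE zE.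
split.
  apply/(ext_zero_shift _ _ ip (@projective_row R n) hY).
  by case: (eG k.+2).
(* Only Ext^1 is out of reach of the shift: G being reflexive, a functional on its dual is
   evaluation at some p x, and extends as evaluation at x. *)
case: k => [|k].
  apply: (ext_zero_one ipe (@projective_row R n) hX) => u.
  have [g gE] := oG u; have [x xE] := ps g.
  have evL : linear (fun y : 'rV[R]_n => (e y : hom _ _) x : R^o).
    by move=> a y z; rewrite linearP.
  by exists (mklin evL) => v; rewrite gE /= /mklin_fun e'e xE.
apply/(ext_zero_shift _ _ ipe (@projective_row R n) hX).
by case: (eG k.+1).
Qed.

Lemma fin_gen_dual G : fin_gen G -> fin_gen (dual G).
Proof.
move=> /fin_genP[n [f fs]]; have [e eb _] := dual_row n.
have [e' ee' e'e] := linear_bij_inv eb.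
have fi : injective (e' \o dmap f).
  apply: inj_comp (can_inj e'e) _ => u v uv; apply: hom_inj => y.
  have [x ->] := fs y; exact: (congr1 (fun w : hom _ _ => w x) uv).
exact: (fin_gen_sub Rn fi (@fin_gen_row R n)).
Qed.

Lemma totally_reflexive_dual G : totally_reflexive G -> totally_reflexive (dual G).
Proof.
move=> [fG bG eG]; have /biduality_bijP[tG oG] := bG.
have bL := @biduality_is_linear G.
split=> [||n n0]; first exact: fin_gen_dual.
  apply/biduality_bijP; split=> [u u0|Xi].
    by apply: hom_inj => x; apply: (u0 (biduality x)).
  exists (to_hom (Xi \o mklin bL)) => w.
  have [x xE] := oG (w : {linear dual G -> R^o}).
  rewrite xE /= /mklin_fun; congr (Xi _); apply: hom_inj => u; exact: xE.
have [e1 e2] := eG n n0; split=> //.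
exact: (ext_zero_iso (e := mklin bL)) e1.
Qed.

(** Present the dual of G with syzygy Z and dualize: the bidual of G, that is G, embeds in R^n with
    cokernel the dual of Z. *)
Lemma totally_reflexive_cosyzygy G : totally_reflexive G ->
  exists n C (i : {linear G -> 'rV[R]_n}) (p : {linear 'rV[R]_n -> C}),
    short_exact i p /\ totally_reflexive C.
Proof.
move=> hG; have hD := totally_reflexive_dual hG; have [fD _ _] := hD.
have [n [Z [i [p [ip fZ]]]]] := fin_gen_syzygy Rn fD.
have hZ := totally_reflexive_syzygy ip hD.
have [pi' ex' is'] := short_exact_dual ip (totally_reflexive_ext1 hD).
have [e eb eE] := dual_row n; have [e' ee' e'e] := linear_bij_inv eb.
have [_ bG _] := hG.
have bL := @biduality_is_linear G.
exists n, (dual Z), (e' \o (dmap p \o mklin bL)), (dmap i \o e).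
split; last exact: totally_reflexive_dual.
split=> [|x|c].
- exact: inj_comp (can_inj e'e) (inj_comp pi' (bij_inj bG)).
- split=> [/ex'[a aE]|[a ->]]; last by apply/ex'; exists (biduality a); rewrite /= e'e.
  have [b bK Kb] := bG; exists (b a).
  by rewrite /= /mklin_fun Kb -aE ee'.
- by have [b ->] := is' c; exists (e' b); rewrite /= e'e.
Qed.

Lemma totally_reflexive_class : reflexive_class (@totally_reflexive R).
Proof.
move=> G hG; have [fG _ _] := hG; split=> //; first exact: totally_reflexive_ext1.
  have [n [Z [i [p [ip fZ]]]]] := fin_gen_syzygy Rn fG.
  by exists n, Z, i, p; split=> //; apply: totally_reflexive_syzygy ip hG.
exact: totally_reflexive_cosyzygy.
Qed.

End TotallyReflexive.
End Reflexive.

(** * Extensions and approximations *)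

Section Extension.
Variable R : comNzRingType.
Implicit Types A B C E G H K M N P Z : lmodType R.

Lemma short_exact_comp0 A B C (i : {linear A -> B}) (p : {linear B -> C}) a :
  short_exact i p -> p (i a) = 0.
Proof. by case=> _ h _; apply/h; exists a. Qed.

Lemma row_totally_reflexive n : totally_reflexive 'rV[R]_n.
Proof.
apply: (@class_totally_reflexive R (@free_row R)); last by exists n.
move=> _ [k ->]; split; first exact: fin_gen_row.
- exact/ext1_projective/projective_row.
- exists k, 'rV[R]_0, \0, idfun; split; last by exists 0%N.
  split=> [x y _|x|c]; [by apply/rowP => -[] | | by exists c].
  by split=> [x0|[y ->]] //; exists 0.
- exists k, 'rV[R]_0, idfun, \0; split; last by exists 0%N.
  split=> // [x|c]; last by exists 0; apply/rowP => -[].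
  by split=> // _; exists x.
Qed.

(** The map u is extended in two stages, to the preimage of A in B and then to B; the successive
    quotients are A and C. *)
Lemma ext1_extension A E C N (i : {linear A -> E}) (p : {linear E -> C}) :
  short_exact i p -> ext1 A N -> ext1 C N -> ext1 E N.
Proof.
move=> ip hA hC X B j q jq u.
have [ii ex ps] := ip; have [ji jex qs] := jq.
have pqs c : exists b, c = (p \o q) b.
  by have [e ->] := ps c; have [b ->] := qs e; exists b.
have [x|j' jE] := lift_kermod (f := j) (g := p \o q).
  by rewrite /= (short_exact_comp0 x jq) linear0.
have [z|q' qE] := lift_inj (f := q \o (val : {linear kermod (p \o q) -> B})) ii.
  by apply/ex; apply: (kermodP z).
have jq' : short_exact j' q'.
  split=> [x y xy|z|a].
  - by apply: ji; rewrite -!jE xy.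
  - split=> [z0|[x ->]].
      have /jex[x xE] : q (val z) = 0 by rewrite [LHS]qE z0 linear0.
      by exists x; apply: val_inj; rewrite xE jE.
    by apply: ii; rewrite -qE linear0 /= jE; apply: short_exact_comp0 jq.
  - have [b bE] := qs (i a).
    have /kermod_ex[z zE] : (p \o q) b = 0.
      by rewrite /= -bE; apply: short_exact_comp0 ip.
    by exists z; apply: ii; rewrite -qE /= zE.
have [v vE] := hA _ _ _ _ jq' u.
have [w wE] := hC _ _ _ _ (short_exact_ker pqs) v.
by exists w => x; rewrite vE wE /= jE.
Qed.

Lemma linear_row_mxl a c : linear (fun x : 'rV[R]_a => row_mx x (0 : 'rV[R]_c)).
Proof. by move=> k x y; rewrite scale_row_mx add_row_mx scaler0 addr0. Qed.

Lemma horseshoe_syzygy A E C (ZA ZC : lmodType R) a c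
    (i : {linear A -> E}) (p : {linear E -> C})
    (jA : {linear ZA -> 'rV[R]_a}) (qA : {linear 'rV[R]_a -> A})
    (jC : {linear ZC -> 'rV[R]_c}) (qC : {linear 'rV[R]_c -> C}) :
  short_exact i p -> short_exact jA qA -> short_exact jC qC ->
  exists (Z : lmodType R) (i' : {linear ZA -> Z}) (p' : {linear Z -> ZC})
    (j : {linear Z -> 'rV[R]_(a + c)}) (q : {linear 'rV[R]_(a + c) -> E}),
    short_exact i' p' /\ short_exact j q.
Proof.
move=> ip jqA jqC; have [ii ex ps] := ip; have [jAi exA qAs] := jqA.
have [jCi exC qCs] := jqC; have [s sE] := row_lift qC ps.
pose f (x : 'rV[R]_(a + c)) : E := i (qA (lsubmx x)) + s (rsubmx x).
have fL : linear f by move=> k x y; rewrite /f !linearP /= scalerDr addrACA.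
pose q := mklin fL; pose Z : lmodType R := kermod q.
have fs e : exists x, e = q x.
  have [y yE] := qCs (p e).
  have /ex[b bE] : p (e - s y) = 0 by rewrite linearB yE sE subrr.
  have [x xE] := qAs b; exists (row_mx x y).
  by rewrite /= /mklin_fun /f row_mxKl row_mxKr -xE -bE subrK.
have [x|i' iE] := lift_kermod (f := mklin (@linear_row_mxl a c) \o jA) (g := q).
  rewrite /= /mklin_fun /f row_mxKl row_mxKr linear0 addr0.
  by rewrite (short_exact_comp0 x jqA) linear0.
pose g (z : Z) : 'rV[R]_c := rsubmx (val z).
have gL : linear g by move=> k x y; rewrite /g !linearP.
have [z|p' pE] := lift_inj (f := mklin gL) jCi.
  apply/exC; rewrite sE /= /mklin_fun /g.
  have := congr1 p (kermodP z); rewrite /= /mklin_fun /f linearD linear0 => <-.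
  by rewrite (short_exact_comp0 _ ip) add0r.
exists Z, i', p', val, q; split; last exact: short_exact_ker.
split=> [x y xy|z|y].
- apply: jAi; have := congr1 lsubmx (iE x); rewrite xy iE /= /mklin_fun.
  by rewrite !row_mxKl => ->.
- split=> [z0|[x ->]]; last first.
    by apply: jCi; rewrite -pE linear0 /= /mklin_fun /g iE /= /mklin_fun row_mxKr.
  have r0 : rsubmx (val z) = 0 by rewrite -[LHS]/(mklin gL z) pE z0 linear0.
  have /exA[x xE] : qA (lsubmx (val z)) = 0.
    apply: ii; rewrite linear0 -(kermodP z) /= /mklin_fun /f.
    by rewrite [X in s X]r0 linear0 addr0.
  exists x; apply: val_inj; rewrite iE /= /mklin_fun -[LHS]hsubmxK [X in row_mx _ X]r0.
  by rewrite xE.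
- have /ex[b bE] : p (s (jC y)) = 0 by rewrite -sE (short_exact_comp0 y jqC).
  have [x xE] := qAs b.
  have /kermod_ex[z zE] : q (row_mx (- x) (jC y)) = 0.
    by rewrite /= /mklin_fun /f row_mxKl row_mxKr bE xE !linearN addNr.
  by exists z; apply: jCi; rewrite -pE /= /mklin_fun /g zE row_mxKr.
Qed.

Lemma horseshoe_cosyzygy A E C (CA CC : lmodType R) a c
    (i : {linear A -> E}) (p : {linear E -> C})
    (jA : {linear A -> 'rV[R]_a}) (qA : {linear 'rV[R]_a -> CA})
    (jC : {linear C -> 'rV[R]_c}) (qC : {linear 'rV[R]_c -> CC}) :
  short_exact i p -> short_exact jA qA -> short_exact jC qC -> ext1 C R^o ->
  exists (D : lmodType R) (i' : {linear CA -> D}) (p' : {linear D -> CC})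
    (j : {linear E -> 'rV[R]_(a + c)}) (q : {linear 'rV[R]_(a + c) -> D}),
    short_exact i' p' /\ short_exact j q.
Proof.
move=> ip jqA jqC hC; have [ii ex ps] := ip; have [jAi exA qAs] := jqA.
have [jCi exC qCs] := jqC; have [t tE] := ext1_row (n := a) hC ip jA.
pose f (x : E) : 'rV[R]_(a + c) := row_mx (t x) (jC (p x)).
have fL : linear f by move=> k x y; rewrite /f !linearP scale_row_mx add_row_mx.
pose j := mklin fL.
have jl e : lsubmx (j e) = t e by rewrite /= /mklin_fun /f row_mxKl.
have jr e : rsubmx (j e) = jC (p e) by rewrite /= /mklin_fun /f row_mxKr.
have ji : injective j.
  apply: linear_injP => e e0.
  have /ex[b bE] : p e = 0 by apply: jCi; rewrite -jr e0 !linear0.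
  suff b0 : b = 0 by rewrite bE b0 linear0.
  by apply: jAi; rewrite tE -bE -jl e0 !linear0.
have [D [q jq]] := short_exact_coker ji; have [_ exq qs] := jq.
have [x /exA[b ->]|i' iE] := factor_surj (f := q \o mklin (@linear_row_mxl a c)) qAs.
  apply/exq; exists (i b); rewrite /= /mklin_fun /f (short_exact_comp0 b ip).
  by rewrite linear0 tE.
have rL : linear (fun x : 'rV[R]_(a + c) => qC (rsubmx x)).
  by move=> k x y; rewrite !linearP.
have [x /exq[e ->]|p' pE] := factor_surj (f := mklin rL) qs.
  by rewrite -(short_exact_comp0 (p e) jqC) -jr.
exists D, i', p', j, q; split=> //.
split=> [|d|y].
- apply: linear_injP => y; have [x ->] := qAs y.
  rewrite -iE => /exq[e eE].
  have xE : x = t e by rewrite -jl -eE /= /mklin_fun row_mxKl.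
  have /ex[b bE] : p e = 0.
    by apply: jCi; rewrite -jr -eE /= /mklin_fun row_mxKr linear0.
  by apply/exA; exists b; rewrite tE -bE.
- have [x ->] := qs d; split=> [|[y ->]].
    rewrite -pE => /exC[y]; have [e ->] := ps y => eE.
    exists (qA (lsubmx x - t e)); rewrite -iE /=.
    apply/eqP; rewrite -subr_eq0 -linearB; apply/eqP/exq; exists e.
    rewrite -[LHS]hsubmxK -[RHS]/(row_mx (t e) (jC (p e))); congr (row_mx _ _).
      by rewrite linearB [X in _ - X]row_mxKl subKr.
    by rewrite linearB [X in _ - X]row_mxKr subr0.
  have [z ->] := qAs y; rewrite -iE /= -pE /= /mklin_fun.
  by rewrite row_mxKr linear0.
- have [x xE] := qCs y; exists (q (row_mx 0 x)).
  by rewrite -pE /= /mklin_fun row_mxKr.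
Qed.

Hypothesis Rn : noetherian R.

(** By the two horseshoes, a syzygy and a cosyzygy of an extension are again extensions of the same
    kind, so the extensions form a reflexive class. *)
Lemma totally_reflexive_extension A E C (i : {linear A -> E}) (p : {linear E -> C}) :
  short_exact i p -> totally_reflexive A -> totally_reflexive C ->
  totally_reflexive E.
Proof.
pose T E := exists A C (i : {linear A -> E}) (p : {linear E -> C}),
  [/\ short_exact i p, totally_reflexive A & totally_reflexive C].
move=> ip hA hC; apply: (@class_totally_reflexive R T); last by exists A, C, i, p.
move=> {A E C i p ip hA hC} E [A [C [i [p [ip hA hC]]]]].
have [_ eA [a [ZA [jA [qA [jqA tZA]]]]] [a' [CA [jA' [qA' [jqA' tCA]]]]]] :=
  totally_reflexive_class Rn hA.
have [_ eC [c [ZC [jC [qC [jqC tZC]]]]] [c' [CC [jC' [qC' [jqC' tCC]]]]]] :=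
  totally_reflexive_class Rn hC.
have [Z [i' [p' [j [q [ip' jq]]]]]] := horseshoe_syzygy ip jqA jqC.
have [D [i'' [p'' [j' [q' [ip'' jq']]]]]] := horseshoe_cosyzygy ip jqA' jqC' eC.
split.
- by case: jq => _ _ qs; apply/fin_genP; exists (a + c)%N, q.
- exact: ext1_extension ip eA eC.
- by exists (a + c)%N, Z, j, q; split=> //; exists ZA, ZC, i', p'.
- by exists (a' + c')%N, D, j', q'; split=> //; exists CA, CC, i'', p''.
Qed.

End Extension.

(** * Finite free resolutions and totally reflexive approximation *)

Section Length.
Variable R : comNzRingType.
Implicit Types A B C E G H K M N Z : lmodType R.

Fixpoint finite_chain (P : lmodType R -> Prop) (d : nat) M : Prop :=
  if d is d'.+1 then
    exists K G (i : {linear K -> G}) (p : {linear G -> M}),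
      [/\ short_exact i p, P G & finite_chain P d' K]
  else zero_mod M.

(* c is the alternating sum of the ranks, the Euler characteristic of M. *)
Fixpoint finite_free (d : nat) M (c : int) : Prop :=
  if d is d'.+1 then
    exists b K (i : {linear K -> 'rV[R]_b}) (p : {linear 'rV[R]_b -> M}),
      short_exact i p /\ finite_free d' K (b%:Z - c)
  else zero_mod M /\ c = 0.

Lemma finite_chain_resolution P d M (X : augmented M) : resolution P X ->
  (forall n, (d <= n)%N -> zero_mod (X n)) -> finite_chain P d M.
Proof.
elim: d M X => [|d IH] M X [XP Xe] X0 /=; have /aug_exactP[Xs _] := Xe.
  by move=> x; have [y ->] := Xs x; rewrite (X0 0%N isT y) linear0.
exists (kermod (aug X)), (X 0%N), val, (aug X); split=> //.
  exact: short_exact_ker.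
apply: (IH _ (shift X)); last by move=> n dn; apply: X0.
by split; [move=> n; apply: XP | apply: shift_exact].
Qed.

Lemma ext1_zero H K : zero_mod K -> ext1 H K.
Proof. by move=> K0 A B i p _ u; exists \0 => x; rewrite [LHS]K0. Qed.

Hypothesis Rn : noetherian R.

(** A map from the syzygy Z of H to K lifts to R^b by induction, as Z is totally reflexive; the lift
    extends because Ext^1(H, R) = 0. *)
Lemma ext1_finite_free H d K c : totally_reflexive H -> finite_free d K c -> ext1 H K.
Proof.
elim: d H K c => [|d IH] H K c hH; first by case=> /ext1_zero h _; apply: h.
move=> [b [K' [i [p [ip hK']]]]].
have [fH eH [n [Z [j [q [jq hZ]]]]] _] := totally_reflexive_class Rn hH.
apply: (ext1_presentation jq (@projective_row R n)) => u.
have [w wE] := ext1_lift ip (IH _ _ _ hZ hK') u.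
have [v vE] := ext1_row (n := b) eH jq w.
by exists (p \o v) => x; rewrite wE vE.
Qed.

(** By induction the kernel M' of G0 -> M has an approximation by G'. Embedding G' in a free module
    with totally reflexive cokernel and pushing out moves the approximation from M' to M. *)
Lemma totally_reflexive_approximation d M :
  finite_chain (@totally_reflexive R) d M ->
  exists K G (i : {linear K -> G}) (p : {linear G -> M}),
    [/\ short_exact i p, totally_reflexive G & exists e c, finite_free e K c].
Proof.
elim: d M => [|d IH] M /=.
  move=> M0; exists 'rV[R]_0, 'rV[R]_0, idfun, \0; split.
  - split=> // [x|y]; last by exists 0; rewrite [LHS]M0.
    by split=> // _; exists x.
  - exact: row_totally_reflexive.
  - by exists 0%N, 0; split=> // x; apply/rowP => -[].
move=> [M' [G0 [i0 [p0 [ip0 hG0 /IH[K' [G' [i' [p' [ip' hG' [e [c hK']]]]]]]]]]]].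
have [n [G'' [j [r [jr hG'']]]]] := totally_reflexive_cosyzygy Rn hG'.
have [i0i ex0 p0s] := ip0; have [i'i ex' p's] := ip'; have [ji exj rs] := jr.
(* E is the pushout of G0 and 'rV_n along G', and ker (E -> M) = 'rV_n / K'. *)
pose phi (x : G') : G0 * 'rV[R]_n := (i0 (p' x), j x).
have phiL : linear phi.
  by move=> a x y; rewrite /phi !linearP; apply: injective_projections.
have phii : injective (mklin phiL).
  by apply: linear_injP => x /(congr1 snd) x0; apply: ji; rewrite [LHS]x0 linear0.
have [E [q pq]] := short_exact_coker phii; have [_ exq qs] := pq.
have inlL : linear (fun g : G0 => (g, 0 : 'rV[R]_n)).
  by move=> a x y; apply: injective_projections; rewrite //= scaler0 addr0.
have inrL : linear (fun y : 'rV[R]_n => (0 : G0, y)).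
  by move=> a x y; apply: injective_projections; rewrite //= scaler0 addr0.
have rsndL : linear (fun z : G0 * 'rV[R]_n => r z.2) by move=> a x y; rewrite linearP.
have pfstL : linear (fun z : G0 * 'rV[R]_n => p0 z.1) by move=> a x y; rewrite linearP.
have [z /exq[x ->]|f2 f2E] := factor_surj (f := mklin rsndL) qs.
  exact: short_exact_comp0 jr.
have [z /exq[x ->]|h hE] := factor_surj (f := mklin pfstL) qs.
  exact: short_exact_comp0 ip0.
have hs m : exists x, m = h x.
  by have [g ->] := p0s m; exists (q (g, 0)); rewrite -hE.
(* E is an extension of the cosyzygy G'' by G0, hence totally reflexive. *)
have hE1 : short_exact (q \o mklin inlL) f2.
  split=> [|z|y].
  - apply: linear_injP => g /exq[x [gE /esym jx]].
    have x0 : x = 0 by apply: ji; rewrite jx linear0.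
    by rewrite [g]gE x0 !linear0.
  - have [[g y] ->] := qs z; split=> [|[g' ->]].
      rewrite -f2E => /exj[x yE]; exists (g - i0 (p' x)).
      apply/eqP; rewrite -subr_eq0 -linearB; apply/eqP/exq; exists x.
      by apply: injective_projections; rewrite /= ?subKr ?subr0.
    by rewrite -f2E; exact: linear0.
  - by have [x ->] := rs y; exists (q (0, x)); rewrite -f2E.
have [y|k kE] := lift_kermod (f := q \o mklin inrL) (g := h).
  by rewrite /= -hE; exact: linear0.
exists (kermod h), E, val, h; split; first exact: short_exact_ker.
  exact: totally_reflexive_extension hE1 hG0 hG''.
exists e.+1, (n%:Z - c), n, K', (j \o i'), k; split; last by rewrite subKr.
split=> [|y|z].
- exact: inj_comp ji i'i.
- split=> [y0|[x ->]].
    have /exq[x [xE1 xE2]] : q (0, y) = 0.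
      by rewrite -[LHS](kE y) y0 linear0.
    have /ex'[x' x'E] : p' x = 0 by apply: i0i; rewrite -xE1 linear0.
    by exists x'; rewrite [LHS]xE2 x'E.
  apply: val_inj; rewrite kE linear0; apply/exq; exists (i' x).
  by rewrite /= /mklin_fun /phi (short_exact_comp0 x ip') linear0.
- have [[g y] zE] := qs (val z).
  have /ex0[m' gE] : p0 g = 0 by have := kermodP z; rewrite zE -hE.
  have [x xE] := p's m'; exists (y - j x); apply: val_inj; rewrite kE zE.
  apply/eqP; rewrite -subr_eq0 -linearB; apply/eqP/exq; exists x.
  by apply: injective_projections; rewrite /= ?subKr ?subr0 ?gE ?xE.
Qed.

(** Exactness of Hom(H, -) is carried along the splicing: at each stage maps from H lift, since
    Ext^1(H, -) vanishes on the next syzygy. *)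
Lemma finite_free_resolution d K c : finite_free d K c ->
  exists (X : augmented K) (b : nat -> nat),
    [/\ forall n, X n = 'rV[R]_(b n), aug_exact X,
        forall H, totally_reflexive H -> hom_aug_exact H X,
        forall n, (d <= n)%N -> b n = 0%N &
        c = \sum_(n < d) (-1) ^+ n * (b n)%:Z].
Proof.
elim: d K c => [|d IH] K c /=.
  move=> [K0 ->]; pose t (n : nat) : lmodType R := 'rV[R]_0.
  pose z n : {linear t n.+1 -> t n} := \0.
  have zK n x : z n (z n.+1 x) = 0 by [].
  pose a : {linear Complex zK 0%N -> K} := \0.
  have aK x : a (cdiff (Complex zK) 0%N x) = 0 by [].
  have t0 n (x : t n) : x = 0 by apply/rowP => -[].
  exists (Augmented aK), (fun=> 0%N); split=> //; last by rewrite big_ord0.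
    split=> [n x _|x _|x]; [| | by exists 0; rewrite [LHS]K0];
    by exists 0; rewrite [LHS](t0 _).
  move=> H _; split=> [n u _|u _|u]; exists \0 => x; [| | by rewrite [LHS]K0];
    by rewrite [LHS](t0 _).
move=> [b0 [K' [i [p [ip hK']]]]].
have [X [b [XE Xe Xh b0' cE]]] := IH _ _ hK'.
exists (splice ip X), (fun n => if n is n'.+1 then b n' else b0); split.
- by case=> [//|n]; apply: XE.
- exact: splice_exact.
- move=> H hH; apply: splice_hom_exact; first exact: Xh.
  exact: ext1_lift ip (ext1_finite_free hH hK').
- by case=> // n dn; apply: b0'.
- rewrite big_ord_recl /= expr0 mul1r -[LHS](subKr b0%:Z) cE -sumrN.
  by congr (_ + _); apply: eq_bigr => n _; rewrite /= exprS mulN1r mulNr.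
Qed.
End Length.

(** * The fraction field at a prime ideal *)

Lemma fraction_ex (D : idomainType) (z : {fraction D}) :
  exists a b : D, b != 0 /\ z * tofrac b = tofrac a.
Proof.
exists (frac (repr z)).1, (frac (repr z)).2; split; first exact: denom_ratioP.
rewrite -{1}[z]reprK; unlock tofrac; rewrite -[LHS]FracField.pi_mul.
apply/eqP; rewrite FracField.equivf_def /FracField.mulf /=.
have d0 := denom_ratioP (repr z).
by rewrite !numden_Ratio ?(oner_neq0, mul1r, mulr1) // mulrC.
Qed.

Section PrimeField.
Variables (R : comNzRingType) (I : {pred R}).
Hypotheses (hI : idealr_closed I) (pI : forall a b, a * b \in I -> a \in I \/ b \in I).

(** Both proofs are arguments so that the prime ideal structure, and the quotient ring over it, can
    be inferred from the term. *)
Definition prime_pred of idealr_closed I & (forall a b, a * b \in I -> a \in I \/ b \in I)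
  : {pred R} := fun a => a \in I.
Local Notation J := (prime_pred hI pI).
Fact prime_pred_idealr : idealr_closed J. Proof. exact: hI. Qed.
HB.instance Definition _ := isIdealr.Build R J prime_pred_idealr.
Fact prime_pred_prime : prime_idealr_closed J.
Proof. by move=> u v /pI[] h; apply/orP; [left | right]. Qed.
HB.instance Definition _ := isPrimeIdealrClosed.Build R J prime_pred_prime.

Definition prime_quot : Type := {ideal_quot J}.
HB.instance Definition _ := GRing.ComNzRing.on prime_quot.

Definition pq_unit : {pred prime_quot} := fun x => `[< exists y : prime_quot, y * x = 1 >].
Definition pq_inv (x : prime_quot) : prime_quot :=
  if pselect (exists y : prime_quot, y * x = 1) is left h then sval (cid h) else x.
Fact pq_mulVx : {in pq_unit, left_inverse 1 pq_inv *%R}.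
Proof. by move=> x /asboolP h; rewrite /pq_inv; case: pselect => // h'; case: cid. Qed.
Fact pq_unitPl (x y : prime_quot) : y * x = 1 -> pq_unit x.
Proof. by move=> h; apply/asboolP; exists y. Qed.
Fact pq_inv_out : {in [predC pq_unit], pq_inv =1 id}.
Proof. by move=> x /asboolP h; rewrite /pq_inv; case: pselect. Qed.
HB.instance Definition _ := GRing.ComNzRing_hasMulInverse.Build prime_quot
  pq_mulVx pq_unitPl pq_inv_out.
Fact pq_integral : GRing.integral_domain_axiom prime_quot.
Proof. by move=> x y xy; apply: (@Quotient.rquot_IdomainAxiom R J). Qed.
HB.instance Definition _ := GRing.ComUnitRing_isIntegral.Build prime_quot pq_integral.

Definition pq_pi (a : R) : prime_quot := (\pi_({ideal_quot J}) a)%qT.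
Lemma pq_pi_zmod : zmod_morphism pq_pi.
Proof. by move=> a b; apply: (@raddfB _ _ (\pi_({ideal_quot J}))%qT). Qed.
Lemma pq_pi_monoid : monoid_morphism pq_pi.
Proof.
split; first exact: (@rmorph1 _ _ (\pi_({ideal_quot J}))%qT).
by move=> a b; apply: (@rmorphM _ _ (\pi_({ideal_quot J}))%qT).
Qed.
HB.instance Definition _ := GRing.isZmodMorphism.Build R prime_quot pq_pi pq_pi_zmod.
HB.instance Definition _ := GRing.isMonoidMorphism.Build R prime_quot pq_pi pq_pi_monoid.

Lemma prime_field : exists (k : fieldType) (f : {rmorphism R -> k}),
  (forall a, (f a == 0) = (a \in I)) /\
  forall z, exists a b, b \notin I /\ z * f b = f a.
Proof.
exists {fraction prime_quot}, (@tofrac prime_quot \o pq_pi); split=> [a|z].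
  rewrite /= tofrac_eq0.
  have := Quotient.idealrBE J a 0; rewrite subr0 => ->.
  by rewrite -(rmorph0 pq_pi).
have [x [y [y0 xy]]] := fraction_ex z.
have piK (q : prime_quot) : exists a, q = pq_pi a.
  by exists (repr q); apply/esym/(@reprK _ {ideal_quot J}).
have [[a aE] [b bE]] := (piK x, piK y).
exists a, b; rewrite /= -aE -bE; split=> //.
apply: contraNN y0 => bI; rewrite bE -(rmorph0 pq_pi).
by have := Quotient.idealrBE J b 0; rewrite subr0 => <-.
Qed.
End PrimeField.

(** * Associated primes and generic rank *)

Section Maximal.
Variable R : comNzRingType.
Implicit Types (I J : {pred R^o}) (Q : {pred R^o} -> Prop).
Hypothesis Rn : noetherian R.

(** Otherwise choice yields a strictly increasing sequence; the finitely many generators of its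
    union lie in one term, where the sequence must stop. *)
Lemma noetherian_maximal Q I0 : Q I0 -> (forall I, Q I -> submod_closed I) ->
  exists I, [/\ Q I, {subset I0 <= I} &
    forall J, Q J -> {subset I <= J} -> {subset J <= I}].
Proof.
move=> Q0 Qi; apply: contrapT => /forallNP noI.
pose T := {I : {pred R^o} | Q I /\ {subset I0 <= I}}.
pose E (_ : nat) (I J : T) := {subset sval I <= sval J} /\ ~ {subset sval J <= sval I}.
have next n (I : T) : exists J : T, E n I J.
  case: I => I [QI I0I]; apply: contrapT => /forallNP h.
  apply: (noI I); split=> // J QJ IJ; apply: contrapT => JI.
  have QJ0 : Q J /\ {subset I0 <= J} by split=> // x /I0I/IJ.
  exact: (h (exist _ J QJ0) (conj IJ JI)).
have t0 : Q I0 /\ {subset I0 <= I0} by split.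
have [s _ sE] := @dependent_choice_rel (fun=> T) E (exist _ I0 t0) next.
have mono n p : (n <= p)%N -> {subset sval (s n) <= sval (s p)}.
  move=> /subnK <-; elim: (p - n)%N => [//|k IH] x /IH.
  by rewrite addSn; apply: (proj1 (sE _)).
pose U : {pred R^o} := fun x => `[< exists n, x \in sval (s n) >].
have sc n : submod_closed (sval (s n)) by apply: Qi; case: (svalP (s n)).
have Uc : submod_closed U.
  split=> [|a x y /asboolP[n xn] /asboolP[p yp]]; apply/asboolP.
    by exists 0%N; case: (sc 0%N).
  exists (maxn n p); have [_] := sc (maxn n p); apply.
    exact: (mono n) (leq_maxl _ _) _ xn.
  exact: (mono p) (leq_maxr _ _) _ yp.
have [l lE] := Rn Uc.
have [N hN] : exists N, {subset l <= sval (s N)}.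
  have : {subset l <= U} by move=> x xl; rewrite lE; apply: mem_span.
  elim: (l) => [|x l' IH] hl; first by exists 0%N.
  have [|N hN] := IH; first by move=> y yl; apply: hl; rewrite inE yl orbT.
  have /asboolP[n xn] := hl x (mem_head _ _).
  exists (maxn n N) => y; rewrite inE => /predU1P[->|/hN yN].
    exact: (mono n) (leq_maxl _ _) _ xn.
  exact: (mono N) (leq_maxr _ _) _ yN.
have [_] := sE N; apply=> x xN.
apply: (span_min (sc N) hN); rewrite -lE; apply/asboolP; by exists N.+1.
Qed.

(** Ann(s) is maximal among annihilators of nonzero elements, hence an associated prime; it is
    represented by s because s itself is used later. *)
Definition maximal_annihilator (s : R) : Prop :=
  s <> 0 /\ forall z, z <> 0 -> (forall a, a * s = 0 -> a * z = 0) ->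
    forall a, a * z = 0 -> a * s = 0.

Lemma maximal_annihilator_prime s a b : maximal_annihilator s ->
  a * b * s = 0 -> a * s = 0 \/ b * s = 0.
Proof.
move=> [s0 sm] abs; have [bs|bs] := pselect (b * s = 0); [by right | left].
by apply: (sm (b * s) bs) => [c cs|]; rewrite ?mulrA // mulrAC cs mul0r.
Qed.

Lemma maximal_annihilator_ex (y : R) : y <> 0 ->
  exists s, maximal_annihilator s /\ forall a, a * y = 0 -> a * s = 0.
Proof.
move=> y0; pose An (z : R) : {pred R^o} := fun a => `[< a * z = 0 >].
pose Q I := exists2 z : R, z <> 0 & I =i An z.
have [||I [[s s0 sE] yI Im]] := @noetherian_maximal Q (An y).
- by exists y.
- move=> I [z _ zE]; split=> [|a u v]; rewrite !zE; first by apply/asboolP; rewrite mul0r.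
  move=> /asboolP uz /asboolP vz; apply/asboolP.
  by rewrite mulrDl -mulrA uz vz mulr0 addr0.
exists s; split=> [|a ay]; last by apply/asboolP; rewrite -[`[< _ >]]sE; apply/yI/asboolP.
split=> // z z0 sz a az; apply/asboolP; rewrite -[`[< _ >]]sE.
apply: (Im (An z)); [by exists z | | exact/asboolP].
by move=> c; rewrite sE => /asboolP/sz ?; apply/asboolP.
Qed.

Lemma annihilator_separation (s : R) (l : seq R) : maximal_annihilator s ->
  (forall t, t \in l -> exists c, c * t = 0 /\ c * s <> 0) ->
  exists c, c * s <> 0 /\ forall t, t \in l -> c * t = 0.
Proof.
move=> sm; elim: l => [|t l IH] h; first by exists 1; rewrite mul1r; case: sm.
have [|c [cs cl]] := IH; first by move=> u ul; apply: h; rewrite inE ul orbT.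
have [d [dt ds]] := h t (mem_head _ _).
exists (c * d); split; first by case/(maximal_annihilator_prime sm).
move=> u; rewrite inE => /predU1P[->|/cl cu]; first by rewrite -mulrA dt mulr0.
by rewrite mulrAC cu mul0r.
Qed.

(** If Ann(t) were contained in Ann(s), maximality of Ann(t) would force equality. *)
Lemma maximal_annihilator_distinct s t : maximal_annihilator s ->
  maximal_annihilator t -> (exists r, r * s = 0 /\ r * t <> 0) ->
  exists c, c * t = 0 /\ c * s <> 0.
Proof.
move=> [s0 sm] [t0 tm] [r [rs rt]]; apply: contrapT => /forallNP h; apply: rt.
apply: (tm s) => // a at0; apply: contrapT => as0; exact: (h a).
Qed.

Lemma regular_element J : submod_closed J ->
  (forall s, maximal_annihilator s -> exists2 a, a \in J & a * s <> 0) ->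
  exists2 r : R, r \in J & GRing.lreg r.
Proof.
move=> [J0 Jc] hJ.
pose Q I := exists2 l : seq R^o,
  forall t, t \in l -> maximal_annihilator t & I =i span (mem l).
have [||I [[l lm lE] _ Im]] := @noetherian_maximal Q (span (mem ([::] : seq R^o))).
- by exists [::].
- move=> I [l' _ IE]; have [h0 hc] := @span_submod_closed R R^o (mem l').
  by split=> [|a u v]; rewrite !IE; [ | apply: hc].
have all_in s : maximal_annihilator s -> s \in span (mem l).
  move=> sm; rewrite -lE; apply: (Im (span (mem ((s : R^o) :: l)))).
  - exists (s :: l) => // t; rewrite inE => /predU1P[->|/lm] //.
  - move=> x; rewrite lE; apply: span_min; first exact: span_submod_closed.
    by move=> y yl; apply: mem_span; rewrite inE [y \in l]yl orbT.
  - by apply: mem_span; rewrite inE eqxx.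
have [r rJ rl] : exists2 r : R, r \in J & forall t, t \in l -> r * t <> 0.
  elim: (l) lm => [|s l' IH] lm'; first by exists 0.
  have sm := lm' s (mem_head _ _).
  have [|r rJ rl] := IH; first by move=> t tl; apply: lm'; rewrite inE tl orbT.
  have [rs|rs] := pselect (r * s = 0); last first.
    by exists r => // t; rewrite inE => /predU1P[->|/rl].
  have [|c [cs cl]] := @annihilator_separation s l' sm.
    move=> t tl; apply: maximal_annihilator_distinct => //.
      by apply: lm'; rewrite inE tl orbT.
    by exists r; split=> //; apply: rl.
  (* The factor c kills the elements already treated, where r is good; on s, where r vanishes, c a
     does not since Ann(s) is prime. *)
  have [a aJ as0] := hJ s sm; exists (c * a + r); first exact: (Jc c).
  move=> t; rewrite inE mulrDl => /predU1P[->|tl]; last first.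
    by rewrite mulrAC cl // mul0r add0r; apply: rl.
  by rewrite rs addr0 => /(maximal_annihilator_prime sm)[].
(* A zero divisor r lies in some Ann(s), so Ann(s) differs from every Ann(t) with t in l. Some c
   then kills l but not s, although s is in the span of l. *)
exists r => // y z; rewrite -[r * z]addr0 => /eqP.
rewrite addrC -subr_eq -mulrBr => /eqP ryz; apply/eqP; rewrite -subr_eq0.
apply/eqP; apply: contrapT => /maximal_annihilator_ex[s [sm /(_ _ ryz) rs]].
have [|c [cs cl]] := @annihilator_separation s l sm.
  move=> t tl; apply: maximal_annihilator_distinct => //; first exact: lm.
  by exists r; split=> //; apply: rl.
apply: cs; have := all_in s sm; pose K : {pred R^o} := fun x => c * x == 0.
have Kc : submod_closed K.
  split=> [|a u v]; rewrite !unfold_in /K ?mulr0 // => /eqP cu /eqP cv.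
  by rewrite mulrDr mulrCA cu cv mulr0 addr0.
move=> /(span_min Kc) h; apply/eqP/h => t tl; apply/eqP; exact: cl.
Qed.

End Maximal.

(** * Rank at an associated prime *)

Section GenericRank.
Variables (R : comNzRingType) (s : R).
Hypotheses (s0 : s <> 0) (sp : forall a b : R, a * b * s = 0 -> a * s = 0 \/ b * s = 0).

Let ann_s : {pred R} := fun a => a * s == 0.
Lemma annihilator_idealr : idealr_closed ann_s.
Proof.
split=> [||a u v]; rewrite !unfold_in /ann_s ?mul0r ?mul1r //; first exact/eqP.
by move=> /eqP us /eqP vs; rewrite mulrDl -mulrA us vs mulr0 addr0.
Qed.
Lemma annihilator_field : exists (k : fieldType) (f : {rmorphism R -> k}),
  (forall a, f a = 0 <-> a * s = 0) /\ forall z, exists a b, f b != 0 /\ z * f b = f a.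
Proof.
have pp a b : a * b \in ann_s -> a \in ann_s \/ b \in ann_s.
  by move=> /eqP /sp[] /eqP; [left | right].
have [k [f [f0 fE]]] := prime_field annihilator_idealr pp.
exists k, f; split=> [a|z]; first by split=> /eqP; rewrite ?f0 => h; apply/eqP; rewrite ?f0.
by have [a [b [bp zE]]] := fE z; exists a, b; rewrite f0.
Qed.

Section Field.
Variables (k : fieldType) (f : {rmorphism R -> k}).
Hypothesis fE : forall z, exists a b, f b != 0 /\ z * f b = f a.

Lemma clear_denominators m n (V : 'M[k]_(m, n)) :
  exists (X : 'M[R]_(m, n)) (d : R), f d != 0 /\ map_mx f X = f d *: V.
Proof.
have /choice[a /choice[b ab]] : forall ij : 'I_m * 'I_n, exists a b,
  f b != 0 /\ V ij.1 ij.2 * f b = f a by move=> ij; apply: fE.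
exists (\matrix_(i, j) (a (i, j) * \prod_(ij | ij != (i, j)) b ij)), (\prod_ij b ij).
split; first by rewrite rmorph_prod; apply/prodf_neq0 => ij _; case: (ab ij).
apply/matrixP => i j; rewrite !mxE [in RHS](bigD1 (i, j)) //= !rmorphM.
by case: (ab (i, j)) => _ /= <-; rewrite -mulrA mulrC.
Qed.

(** The new rows span, over k, a complement of the row space, and are cleared of denominators. *)
Lemma complete_row_free r b (A : 'M[R]_(r, b)) : row_free (map_mx f A) ->
  exists c (X : 'M[R]_(c, b)), b = (r + c)%N /\ row_free (map_mx f (col_mx A X)).
Proof.
move=> Af; set B := map_mx f A in Af.
have [X [d [d0 XE]]] := clear_denominators (row_base B^C%MS).
have rB : \rank B = r by apply/eqP.
have rb : (r <= b)%N by rewrite -rB rank_leq_col.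
exists (\rank B^C%MS), X; split; first by rewrite mxrank_compl rB subnKC.
rewrite map_col_mx XE -row_leq_rank -addsmxE.
rewrite mxrank_disjoint_sum; last first.
  apply/eqP; rewrite -submx0 -(capmx_compl B).
  by rewrite capmxS ?submx_refl // scalemx_sub // eq_row_base.
by rewrite rB (eqmx_scale _ d0) eq_row_base mxrank_compl rB.
Qed.

Lemma row_free_lift r b (A : 'M[R]_(r, b)) :
  (forall x : 'rV[R]_r, map_mx f (x *m A) = 0 -> map_mx f x = 0) ->
  row_free (map_mx f A).
Proof.
move=> h; apply: inj_row_free => v vA; have [X [d [d0 XE]]] := clear_denominators v.
have : map_mx f X = 0 by apply: h; rewrite map_mxM XE -scalemxAl vA scaler0.
by rewrite XE => /eqP; rewrite scaler_eq0 (negPf d0) => /eqP.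
Qed.

End Field.

(* K becomes free of rank r after localization at the prime Ann(s). *)
Definition generic_free (K : lmodType R) r : Prop :=
  exists t (al : {linear 'rV[R]_r -> K}) (be : {linear K -> 'rV[R]_r}),
    [/\ t * s <> 0, forall x, be (al x) = t *: x & forall x, al (be x) = t *: x].

Section Inject.
Variables (k : fieldType) (f : {rmorphism R -> k}).
Hypothesis f0 : forall a, f a = 0 <-> a * s = 0.

Lemma map_mx_eq0_ann n (x : 'rV[R]_n) : map_mx f x = 0 <-> s *: x = 0.
Proof.
split=> /rowP h; apply/rowP => j; have := h j; rewrite !mxE.
  by rewrite mulrC => /f0.
by move=> sx; apply/f0; rewrite mulrC.
Qed.

(** From t s x = 0 and t outside p = Ann(s), primality gives s x = 0, which says that x vanishes
    modulo p. *)
Lemma generic_free_kernel (K : lmodType R) r (t : R) (al : {linear 'rV[R]_r -> K})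
    (be : {linear K -> 'rV[R]_r}) x : t * s <> 0 ->
  (forall y, be (al y) = t *: y) -> al (s *: x) = 0 -> map_mx f x = 0.
Proof.
move=> ts tE h; apply/map_mx_eq0_ann/rowP => j.
have /rowP/(_ j) := tE (s *: x); rewrite h linear0 !mxE => xs.
have : x 0 j * t * s = 0 by rewrite mulrAC mulrC [x 0 j * s]mulrC -xs.
by case/sp => // xjs; rewrite mulrC.
Qed.
End Inject.

(** The syzygy is free at p by induction, and its inclusion in R^b stays injective modulo p. A basis
    of it therefore completes to one of R^b, and the added vectors form a basis of the quotient at
    p. *)
Lemma finite_free_generic d (K : lmodType R) c : finite_free d K c ->
  exists2 r : nat, c = r%:Z & generic_free K r.
Proof.
elim: d K c => [|d IH] K c /=.
  move=> [K0 ->]; exists 0%N => //; exists 1, \0, \0; split; rewrite ?mul1r //.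
  - by move=> x; apply/rowP => -[].
move=> [b [K' [i [q [iq /IH[r cE [t [al [be [ts beal albe]]]]]]]]]].
have [ii ex qs] := iq.
have [k [f [f0 fE]]] := annihilator_field.
pose A : 'M[R]_(r, b) := lin1_mx (i \o al).
have AE x : x *m A = i (al x) by rewrite mul_rV_lin1.
have /(complete_row_free fE)[n [X [bE Xf]]] : row_free (map_mx f A).
  apply: (row_free_lift fE) => x /(map_mx_eq0_ann f0); rewrite AE -!linearZ /= => h.
  apply: (generic_free_kernel f0 ts beal); apply: ii; by rewrite linear0.
subst b; exists n.
  by rewrite -(subKr (r + n)%N%:Z c) cE PoszD addrAC subrr add0r.
pose W := col_mx A X; have Wd : \det W * s <> 0.
  by move/f0/eqP; apply/negP; move: Xf; rewrite row_free_unit unitmxE det_map_mx unitfE.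
(* Up to t and det W, this reads off coordinates along the rows of X. It kills the rows of A; the
   factor t makes it kill all of K', since t K' lies in the image of [al]. *)
pose g (x : 'rV[R]_(r + n)) : 'rV[R]_n := t *: rsubmx (x *m \adj W).
have gL : linear g.
  by move=> a x y; rewrite /g mulmxDl -scalemxAl !linearP.
pose h (y : 'rV[R]_n) : K := q (y *m X).
have hL : linear h by move=> a x y; rewrite /h mulmxDl -scalemxAl linearP.
have gA y : rsubmx (y *m A *m \adj W) = 0.
  have -> : y *m A = row_mx y 0 *m W by rewrite mul_row_col mul0mx addr0.
  by rewrite -mulmxA mul_mx_adj mul_mx_scalar scale_row_mx scaler0 row_mxKr.
have [x /ex[z ->]|g' gE] := factor_surj (f := mklin gL) qs.
  rewrite /= /mklin_fun /g -[RHS](gA _ (be z)) AE albe [i _]linearZ /= -scalemxAl.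
  by rewrite [RHS]linearZ.
exists (t * \det W), (mklin hL), g'; split=> [|x|x].
- by case/sp.
- rewrite /= /mklin_fun /h -gE /= /mklin_fun /g.
  have -> : x *m X = row_mx 0 x *m W by rewrite mul_row_col mul0mx add0r.
  by rewrite -mulmxA mul_mx_adj mul_mx_scalar scale_row_mx row_mxKr scalerA.
- have [z ->] := qs x; rewrite -gE /= /mklin_fun /h /g -[RHS]linearZ.
  apply/eqP; rewrite -subr_eq0 -linearB; apply/eqP/ex.
  exists (- al (t *: lsubmx (z *m \adj W))).
  have dz : \det W *: z = lsubmx (z *m \adj W) *m A + rsubmx (z *m \adj W) *m X.
    by rewrite -mul_row_col hsubmxK -mulmxA mul_adj_mx mul_mx_scalar.
  rewrite [RHS]linearN -AE -scalerA dz scalerDr -!scalemxAl.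
  by rewrite [X in _ - X]addrC opprD addrA subrr add0r.
Qed.

Lemma finite_free_ann d (M : lmodType R) c r : finite_free d M c -> GRing.lreg r -> 
  (forall x : M, r *: x = 0) -> c = 0.
Proof.
move=> /finite_free_generic[[//|n] -> [t [al [be [ts beal _]]]]] rr rM.
case: ts; suff -> : t = 0 by rewrite mul0r.
apply: rr; rewrite mulr0.
(* In positive rank, r kills t times a basis vector, so r t = 0 and t would vanish. *)
have /rowP/(_ 0) : r *: be (al (delta_mx 0 0)) = 0 by rewrite -linearZ rM linear0.
by rewrite beal !mxE !eqxx mulr1.
Qed.

Lemma generic_collapse d (K G M : lmodType R) g (i : {linear K -> G}) (p : {linear G -> M})
    (q : {linear 'rV[R]_g -> G}) :
  short_exact i p -> (forall y, exists x, y = q x) -> finite_free d K g%:Z ->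
  (exists2 a, a * s <> 0 & forall m : M, a *: m = 0) /\
  (exists2 a, a * s <> 0 & forall x, q x = 0 -> a *: x = 0).
Proof.
move=> ip qs /finite_free_generic[r [<-]] [t [al [be [ts beal albe]]]].
have [ii ex ps] := ip; have [k [f [f0 fE]]] := annihilator_field.
have [w wE] := row_lift (i \o al) qs.
pose A : 'M[R]_g := lin1_mx w.
have AE x : q (x *m A) = i (al x) by rewrite mul_rV_lin1 -wE.
(* If x A vanishes modulo p, then s x A = 0, so [al] kills s x by injectivity of i, and x vanishes
   modulo p. *)
have Ad : \det A * s <> 0.
  move/f0/eqP; apply/negP; rewrite -unitfE -det_map_mx -unitmxE -row_free_unit.
  apply: (row_free_lift fE) => x /(map_mx_eq0_ann f0) h.
  apply: (generic_free_kernel f0 ts beal); apply: ii.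
  by rewrite linear0 -AE -scalemxAl h linear0.
have adjA x : \det A *: x = x *m \adj A *m A by rewrite -mulmxA mul_adj_mx mul_mx_scalar.
split.
  exists (\det A) => // m; have [y ->] := ps m; have [x ->] := qs y.
  by rewrite -!linearZ adjA AE; apply/ex; eexists.
exists (t * \det A) => [|x x0]; first by case/sp.
(* If q x = 0, then q kills det A x = (x adj A) A, so [al] kills x adj A. Applying [be] and
   multiplying by A gives t det A x = 0. *)
have /(congr1 be) : al (x *m \adj A) = 0.
  by apply: ii; rewrite -AE -adjA !linearZ /= x0 scaler0 linear0.
rewrite beal linear0 => e; by rewrite -scalerA adjA scalemxAl e mul0mx.
Qed.
End GenericRank.

(** * Tensor products and homology *)

Section TensorTheory.
Variable R : comNzRingType.
Implicit Types A B C M N W : lmodType R.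

Lemma tensor_ind M N (S : {pred tensor M N}) : submod_closed S ->
  (forall x y, pure_tensor x y \in S) -> forall t, t \in S.
Proof.
move=> [S0 Sc] hS t; have [z ->] := mqpi_surj t.
have SD u v : u \in S -> v \in S -> u + v \in S.
  by move=> uS vS; rewrite -[u]scale1r Sc.
have SZ a u : u \in S -> a *: u \in S by move=> uS; rewrite -[_ *: _]addr0 Sc.
rewrite -[z]freeg_sumE linear_sum; elim/big_ind: _ => //= -[x y] _.
have -> k : << k *g (x, y) >> = k *: << (x, y) >> :> {freeg (M * N)%type / R}.
  by apply/eqP/freeg_eqP => u; rewrite coeffZ !coeffU mul1r.
by rewrite linearZ; apply: SZ; apply: hS.
Qed.

Lemma tensor_eq M N W (u v : {linear tensor M N -> W}) :
  (forall x y, u (pure_tensor x y) = v (pure_tensor x y)) -> forall t, u t = v t.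
Proof.
move=> uv t; apply/eqP; pose S : {pred tensor M N} := fun t => u t == v t.
rewrite -[_ == _]/(t \in S); apply: tensor_ind => [|x y]; last exact/eqP.
split=> [|a x y]; rewrite !unfold_in /S ?linear0 // => /eqP xS /eqP yS.
by rewrite !linearP xS yS.
Qed.

Lemma tensor_rel_eq M N z z' : z - z' \in @tensor_rel R M N ->
  mqpi (@tensor_rel R M N) z = mqpi _ z'.
Proof. by move=> h; apply/mqpi_eq; apply: mem_span. Qed.

Lemma pure_tensorDl M N (x x' : M) (y : N) :
  pure_tensor (x + x') y = pure_tensor x y + pure_tensor x' y.
Proof.
rewrite /pure_tensor -linearD; apply: tensor_rel_eq; apply/asboolP.
by constructor 1; exists x, x', y; rewrite opprD addrA.
Qed.
Lemma pure_tensorZl M N a (x : M) (y : N) :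
  pure_tensor (a *: x) y = a *: pure_tensor x y.
Proof.
rewrite /pure_tensor -linearZ; apply: tensor_rel_eq; apply/asboolP.
by constructor 3; exists a, x, y.
Qed.
Lemma pure_tensorZr M N a (x : M) (y : N) :
  pure_tensor x (a *: y) = a *: pure_tensor x y.
Proof.
rewrite /pure_tensor -linearZ; apply: tensor_rel_eq; apply/asboolP.
by constructor 4; exists a, x, y.
Qed.
Lemma pure_tensor0l M N (y : N) : pure_tensor (0 : M) y = 0.
Proof. by rewrite -(scale0r 0) pure_tensorZl scale0r. Qed.

Lemma tensor_lift M N W (b : M -> N -> W) :
  (forall y, linear (b^~ y)) -> (forall x, linear (b x)) ->
  exists u : {linear tensor M N -> W}, forall x y, u (pure_tensor x y) = b x y.
Proof.
move=> bl br; pose f : {linear {freeg (M * N)%type / R} -> W} := fglift (fun p => b p.1 p.2).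
have fE p : f << p >> = b p.1 p.2 by rewrite /f /= liftU scale1r.
have bDl x x' y : b (x + x') y = b x y + b x' y := linearD (mklin (bl y)) x x'.
have bDr x y y' : b x (y + y') = b x y + b x y' := linearD (mklin (br x)) y y'.
have bZl a x y : b (a *: x) y = a *: b x y := linearZZ (mklin (bl y)) a x.
have bZr a x y : b x (a *: y) = a *: b x y := linearZZ (mklin (br x)) a y.
have f0 z : z \in @tensor_rel R M N -> f z = 0.
  case/asboolP => -[a [x [y ->]]]; rewrite ?linearB ?linearZ /= ?linearB !fE /=.
  - by rewrite bDl addrAC addrK subrr.
  - by rewrite bDr addrAC addrK subrr.
  - by rewrite bZl scalerN subrr.
  - by rewrite bZr scalerN subrr.
by exists (mqlift f0) => x y; rewrite [LHS](mqlift_pi f0) fE.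
Qed.

Lemma tensor_map_comp A B C N (f : {linear A -> B}) (g : {linear B -> C}) t :
  tensor_map N g (tensor_map N f t) = tensor_map N (g \o f) t.
Proof.
apply: (tensor_eq (u := tensor_map N g \o tensor_map N f)) => x y.
by rewrite -[LHS]/(tensor_map N g (tensor_map N f (pure_tensor x y))) !tensor_map_pure.
Qed.

Lemma tensor_map_ext A B N (f g : {linear A -> B}) t : (forall x, f x = g x) ->
  tensor_map N f t = tensor_map N g t.
Proof. by move=> fg; apply: tensor_eq => x y; rewrite !tensor_map_pure fg. Qed.

Lemma tensor_map0 A B N (f : {linear A -> B}) t : (forall x, f x = 0) ->
  tensor_map N f t = 0.
Proof.
move=> f0; apply: (tensor_eq (v := \0)) => x y.
by rewrite !tensor_map_pure f0 pure_tensor0l.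
Qed.

Lemma tensor_mapD A B N (f g h : {linear A -> B}) t : (forall x, h x = f x + g x) ->
  tensor_map N h t = tensor_map N f t + tensor_map N g t.
Proof.
move=> fg; apply: (tensor_eq (v := tensor_map N f \+ tensor_map N g)) => x y.
rewrite -[RHS]/(tensor_map N f (pure_tensor x y) + tensor_map N g (pure_tensor x y)).
by rewrite !tensor_map_pure fg pure_tensorDl.
Qed.

Lemma tensor_map_id A N (t : tensor A N) : tensor_map N idfun t = t.
Proof. by apply: (tensor_eq (v := idfun)) => x y; rewrite tensor_map_pure. Qed.

(* t has the left inverse s up to the homotopy (h, k). *)
Lemma homology_injection A B C A' B' C' (f : {linear A -> B}) (g : {linear B -> C})
    (f' : {linear A' -> B'}) (g' : {linear B' -> C'})
    (tA : {linear A -> A'}) (tB : {linear B -> B'}) (tC : {linear C -> C'})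
    (sA : {linear A' -> A}) (sB : {linear B' -> B})
    (h : {linear B -> A}) (k : {linear C -> B}) :
  (forall x, tB (f x) = f' (tA x)) -> (forall x, g' (tB x) = tC (g x)) ->
  (forall x, sB (f' x) = f (sA x)) ->
  (forall x, sB (tB x) = x + (f (h x) + k (g x))) ->
  exists u : {linear homology f g -> homology f' g'}, injective u.
Proof.
move=> tf gt sf ht.
have [z|q qE] := lift_kermod (f := tB \o (val : {linear kermod g -> B})) (g := g').
  by rewrite /= gt kermodP linear0.
set S := (fun z : kermod g => `[< exists a : A, val z = f a >]).
set S' := (fun z : kermod g' => `[< exists a : A', val z = f' a >]).
have [z /mqpi_eq0|u uE] := factor_surj (p := mqpi S) (f := mqpi S' \o q) (@mqpi_surj _ _ S).
  rewrite (submod_closed_span (homology_image_closed f g)) => /asboolP[a za].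
  apply/mqpi_eq0; apply: mem_span; apply/asboolP; exists (tA a).
  by rewrite qE /= za tf.
exists u; apply: linear_injP => w; have [z ->] := mqpi_surj w.
rewrite -uE => /mqpi_eq0; rewrite (submod_closed_span (homology_image_closed f' g')).
move=> /asboolP[a']; rewrite qE /= => tz.
apply/mqpi_eq0; apply: mem_span; apply/asboolP; exists (sA a' - h (val z)).
by have := ht (val z); rewrite tz sf kermodP !linear0 addr0 linearB => ->; rewrite addrK.
Qed.

(** Used in both directions, this makes dimensions over k independent of the proper resolution. *)
Lemma tensor_homology_injection M N (X Y : augmented M) n :
  proper_Gresolution X -> proper_Gresolution Y ->
  exists u : {linear tensor_homology X N n -> tensor_homology Y N n}, injective u.
Proof.
move=> [[XT Xe] XP] [[YT Ye] YP].
have [f [f0 fE]] := comparison XT YP idfun.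
have [g [g0 gE]] := comparison YT XP idfun.
pose e k : {linear aterm X k -> aterm X k} := (g k \o f k) \- idfun.
have e0 x : e 0%N x = 0 by rewrite /e /= g0 f0 /= subrr.
have eE k x : adiff X k (e k.+1 x) = e k (adiff X k x).
  by rewrite /e /= linearB gE fE.
have [h h0 hE] := null_homotopy XT XP e0 eE.
have [t tE] : exists t : {linear X n.-1 -> Y n.-1},
    forall x, cdiff_out Y n (f n.+1 x) = t (cdiff_out X n x).
  by case: n => [|n]; [exists (f 1%N) => x; rewrite /= linear0 | exists (f n.+1); apply: (fE n.+1)].
(* In degree 0 the homotopy starts from the zero map on M, so k = 0 there. *)
have [k kE] : exists k : {linear X n.-1 -> X n},
    forall x, g n.+1 (f n.+1 x) = x + (cdiff X n (h n.+1 x) + k (cdiff_out X n x)).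
  case: (n) => [|j].
    exists \0 => x; have hx := hE 0%N x; rewrite h0 addr0 in hx.
    by rewrite /= addr0 -[cdiff _ _ _]hx /e /= addrC subrK.
  exists (h j.+1) => x; have hx := hE j.+1 x.
  by rewrite -[X in x + X]hx /e /= addrC subrK.
apply: (@homology_injection _ _ _ _ _ _ _ _ _ _ (tensor_map N (f n.+2))
  (tensor_map N (f n.+1)) (tensor_map N t) (tensor_map N (g n.+2))
  (tensor_map N (g n.+1)) (tensor_map N (h n.+1)) (tensor_map N k)) => x.
- by rewrite !tensor_map_comp; apply: tensor_map_ext => y; rewrite /= (esym (fE n.+1 y)).
- by rewrite !tensor_map_comp; apply: tensor_map_ext => y; apply: tE.
- by rewrite !tensor_map_comp; apply: tensor_map_ext => y; rewrite /= (esym (gE n.+1 y)).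
- rewrite !tensor_map_comp.
  have -> := tensor_mapD (h := g n.+1 \o f n.+1) (f := idfun)
    (g := (cdiff X n \o h n.+1) \+ (k \o cdiff_out X n)) x kE; rewrite tensor_map_id.
  by congr (_ + _); apply: tensor_mapD.
Qed.

End TensorTheory.

(** * Local rings and dimensions over the residue field *)

Section Local.
Variables (R : comNzRingType) (m : {pred R}).
Hypotheses (Rn : noetherian R) (Rl : local_ring m).

(** Otherwise x generates a proper ideal; a maximal ideal above it must be m. *)
Lemma local_unit (x : R) : x \notin m -> exists y, y * x = 1.
Proof.
move=> xm; apply: contrapT => /forallNP nox.
pose I0 : {pred R^o} := fun z => `[< exists a, z = a * x >].
have [||I [Ii xI Imax]] := @noetherian_maximal R Rn (fun I => @idealr_closed R I) I0.
- split=> [||a u v /asboolP[b ->] /asboolP[c ->]].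
  + by apply/asboolP; exists 0; rewrite mul0r.
  + by apply/asboolP => -[a ax]; apply: (nox a).
  + by apply/asboolP; exists (a * b + c); rewrite mulrDl mulrA.
- by move=> I [h0 _ h]; split.
have [_ /(_ I)Im] := Rl.
have Imax' : maximal_ideal (I : {pred R}) by split.
move/negP: xm; apply; rewrite -(Im Imax'); apply: xI.
by apply/asboolP; exists 1; rewrite mul1r.
Qed.

Lemma residue_class_field : exists (k : fieldType) (f : {rmorphism R -> k}),
  (forall a, (f a == 0) = (a \in m)) /\ forall z, exists a, f a = z.
Proof.
have [[mi _] _] := Rl; have [m0 m1 mc] := mi.
have unit_or a b : a * b \in m -> a \in m \/ b \in m.
  have [am|am abm] := boolP (a \in m); [by left | right].
  have [c ca] := local_unit am.
  by rewrite -[b]mul1r -ca -mulrA -[_ * _]addr0; apply: mc.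
have [k [f [f0 fE]]] := prime_field mi unit_or.
exists k, f; split=> // z; have [a [b [bm zE]]] := fE z.
have [c cb] := local_unit bm; exists (a * c).
by rewrite rmorphM -zE -mulrA -rmorphM mulrC [b * c]mulrC cb rmorph1 mul1r.
Qed.

Lemma minimal_generators (G : lmodType R) : fin_gen G ->
  exists g (q : {linear 'rV[R]_g -> G}), (forall y, exists x, y = q x) /\
    forall x, q x = 0 -> forall j, x 0 j \in m.
Proof.
move=> /fin_genP fG.
pose P g := `[< exists q : {linear 'rV[R]_g -> G}, forall y, exists x, y = q x >].
have exP : exists g, P g by have [g [q qs]] := fG; exists g; apply/asboolP; exists q.
case: (ex_minnP exP) => g /asboolP[q qs] gmin; exists g, q; split=> // x x0 j.
apply: contrapT => /negP xj; have [c cx] := local_unit xj.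
case: g q qs gmin x x0 j xj cx => [|g] q qs gmin x x0 j xj cx; first by case: j xj cx.
suff /gmin : P g by rewrite ltnn.
apply/asboolP; exists (row_map (fun i => q (delta_mx 0 (fintype.lift j i)))) => y.
(* A relation x with invertible j-th coefficient eliminates the j-th generator, against the
   minimality of g. *)
have [z ->] := qs y; pose w := z - (z 0 j * c) *: x.
have -> : q z = q w by rewrite /w linearB [q (_ *: _)]linearZ_LR x0 scaler0 subr0.
have wj : w 0 j = 0 by rewrite !mxE -mulrA cx mulr1 subrr.
exists (\row_i w 0 (fintype.lift j i)); rewrite [LHS]row_mapE /row_map (bigD1_ord j) //=.
rewrite wj scale0r add0r /row_map; apply: eq_bigr => i _.
by rewrite [in RHS]mxE.
Qed.

(** The idempotent E projecting onto the kernel of a minimal cover has entries in m. So det (1 - E)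
    is a unit, and E (1 - E) = 0 gives E = 0. *)
Lemma projective_free (P : lmodType R) : fin_gen P -> projective P ->
  exists g (q : {linear 'rV[R]_g -> P}), bijective q.
Proof.
move=> /minimal_generators[g [q [qs qm]]] Pp; exists g, q.
have [s sE] := Pp _ _ q idfun qs.
pose u : {linear 'rV[R]_g -> 'rV[R]_g} := idfun \- (s \o q).
pose E := lin1_mx u; have EE x : x *m E = x - s (q x) by rewrite mul_rV_lin1.
have qE x : q (x *m E) = 0 by rewrite EE linearB -sE /= subrr.
have [k [f [f0 _]]] := residue_class_field.
have fE : map_mx f E = 0.
  apply/matrixP => i j; rewrite [LHS]mxE [RHS]mxE; apply/eqP; rewrite f0.
  have -> : E i j = row i E 0 j by rewrite [RHS]mxE.
  by apply: qm; rewrite rowE qE.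
have [c cd] : exists c, c * \det (1%:M - E) = 1.
  by apply: local_unit; rewrite -f0 -det_map_mx map_mxB fE subr0 map_mx1 det1 oner_neq0.
have Ei : E *m (1%:M - E) = 0.
  apply/row_matrixP => i; rewrite !rowE mulmxA mulmxBr mulmx1 mulmx0.
  by rewrite [X in _ - X]EE qE linear0 subr0 subrr.
have E0 : E = 0.
  rewrite -[E]mulmx1 -[1%:M]scale1r -{1}cd -scalerA.
  have -> : \det (1%:M - E) *: 1%:M = (1%:M - E) *m \adj (1%:M - E).
    by rewrite mul_mx_adj scalemx1.
  by rewrite -scalemxAr mulmxA Ei mul0mx scaler0.
exists s => [x|x]; last by rewrite -sE.
by apply/eqP; rewrite eq_sym -subr_eq0 -EE E0 mulmx0.
Qed.

(** * Linear algebra over the residue field *)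

Section KDim.
Variables (k : fieldType) (f : {rmorphism R -> k}).
Hypotheses (f0 : forall a, (f a == 0) = (a \in m)) (fs : forall z, exists a, f a = z).
Implicit Types U V W : lmodType R.

(** A semilinear bijection with k^d: it turns linear maps over R into matrices over k and dimension
    counts into ranks. *)
Definition coordinates V d (phi : V -> 'rV[k]_d) : Prop :=
  (forall a x y, phi (a *: x + y) = f a *: phi x + phi y) /\ bijective phi.

Lemma map_mx_surj p q (X : 'M[k]_(p, q)) : exists Y : 'M[R]_(p, q), map_mx f Y = X.
Proof.
have /choice[Y YE] : forall ij : 'I_p * 'I_q, exists a, f a = X ij.1 ij.2 by move=> ij.
by exists (\matrix_(i, j) Y (i, j)); apply/matrixP => i j; rewrite !mxE YE.
Qed.

Lemma coordinates_ex V d : has_kdim m V d -> exists phi : V -> 'rV[k]_d, coordinates phi.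
Proof.
move=> [mV [e [eg ei]]].
pose q : {linear 'rV[R]_d -> V} := row_map e.
have q0 (x : 'rV[R]_d) : q x = 0 <-> map_mx f x = 0.
  split=> [h|/rowP h].
    by apply/rowP => j; rewrite !mxE; apply/eqP; rewrite f0; apply: (ei (fun i => x 0 i)).
  rewrite /q /= /row_map big1 // => i _; apply: mV; rewrite -f0.
  by have := h i; rewrite !mxE => ->.
have /choice[a aE] : forall v, exists x, v = q x.
  move=> v; have [a ->] := eg v; exists (\row_i a i).
  by apply: eq_bigr => i _; rewrite mxE.
have qL x y : q x = q y <-> map_mx f x = map_mx f y.
  split=> h; apply/eqP; rewrite -subr_eq0.
    by rewrite -map_mxB; apply/eqP/q0; rewrite linearB h subrr.
  by rewrite -linearB; apply/eqP/q0; rewrite map_mxB h subrr.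
exists (fun v => map_mx f (a v)); split=> [c x y|].
  rewrite -map_mxZ -map_mxD; apply/qL; rewrite -aE.
  by rewrite [RHS]linearP -!aE.
exists (fun X => q (sval (cid (map_mx_surj X)))) => [x|X].
  by case: cid => Y /= /qL ->; rewrite -aE.
by case: cid => Y YE /=; rewrite -YE; apply/qL; rewrite -aE.
Qed.

Section Coordinates.
Variables (V W : lmodType R) (d e : nat).
Variables (phi : V -> 'rV[k]_d) (psi : W -> 'rV[k]_e).
Hypotheses (phiC : coordinates phi) (psiC : coordinates psi).

Lemma coordinates0 : phi 0 = 0.
Proof.
by have [h _] := phiC; have := h (-1) 0 0; rewrite scaler0 addr0 rmorphN1 scaleN1r addNr.
Qed.
Lemma coordinatesD x y : phi (x + y) = phi x + phi y.
Proof. by have [h _] := phiC; rewrite -[x]scale1r h rmorph1 !scale1r. Qed.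
Lemma coordinatesZ a x : phi (a *: x) = f a *: phi x.
Proof. by have [h _] := phiC; rewrite -[_ *: _]addr0 h coordinates0 addr0. Qed.
Lemma coordinates_sum n (F : 'I_n -> V) : phi (\sum_i F i) = \sum_i phi (F i).
Proof. exact: (big_morph phi coordinatesD coordinates0). Qed.
Lemma coordinates_inj : injective phi.
Proof. by case: phiC => _ /bij_inj. Qed.
Lemma coordinates_surj X : exists x, phi x = X.
Proof. by have [_ [h hK Kh]] := phiC; exists (h X). Qed.

End Coordinates.

Lemma coordinates_mx V W d e (phi : V -> 'rV[k]_d) (psi : W -> 'rV[k]_e)
    (u : {linear V -> W}) : coordinates phi -> coordinates psi ->
  exists F : 'M[k]_(d, e), forall x, psi (u x) = phi x *m F.
Proof.
move=> pc qc; have [h2 [h hK Kh]] := pc; have [g2 _] := qc.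
have hL : linear (fun X => psi (u (h X))).
  move=> z X Y; have [a <-] := fs z; rewrite -g2 -linearP; congr (psi (u _)).
  by apply: (coordinates_inj pc); rewrite h2 !Kh.
by exists (lin1_mx (mklin hL)) => x; rewrite mul_rV_lin1 /= /mklin_fun hK.
Qed.

Lemma kdim_injective_le V W d e (u : {linear V -> W}) : injective u ->
  has_kdim m V d -> has_kdim m W e -> (d <= e)%N.
Proof.
move=> ui /coordinates_ex[phi pc] /coordinates_ex[psi qc].
have [F FE] := coordinates_mx u pc qc.
have Ff : row_free F.
  apply: inj_row_free => X; have [x <-] := coordinates_surj pc X.
  rewrite -FE -(coordinates0 qc) => /(coordinates_inj qc) h.
  by rewrite -(coordinates0 pc); congr phi; apply: ui; rewrite h linear0.
by rewrite -(eqP Ff) rank_leq_col.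
Qed.

Lemma coordinates_kdim0 V d (phi : V -> 'rV[k]_d) a (v : V) : coordinates phi ->
  a \in m -> a *: v = 0.
Proof.
move=> pc; rewrite -f0 => /eqP fa; apply: (coordinates_inj pc).
by rewrite (coordinatesZ pc) fa scale0r (coordinates0 pc).
Qed.

Lemma homology_kdim (A B C : lmodType R) a b c (u : {linear A -> B}) (v : {linear B -> C})
    (pA : A -> 'rV[k]_a) (pB : B -> 'rV[k]_b) (pC : C -> 'rV[k]_c)
    (F : 'M[k]_(a, b)) (G : 'M[k]_(b, c)) :
  coordinates pA -> coordinates pB -> coordinates pC ->
  (forall x, pB (u x) = pA x *m F) -> (forall x, pC (v x) = pB x *m G) ->
  (forall x, v (u x) = 0) ->
  exists2 h, has_kdim m (homology u v) h & (h + \rank F + \rank G)%N = b.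
Proof.
move=> cA cB cC FE GE vu.
have FG : F *m G = 0.
  apply/row_matrixP => i; rewrite row_mul row0.
  have [x xE] := coordinates_surj cA (delta_mx 0 i).
  by rewrite rowE -xE -FE -GE vu (coordinates0 cC).
have FK : (F <= kermx G)%MS by apply/sub_kermxP.
pose S := row_base (kermx G :\: F)%MS; pose h := \rank (kermx G :\: F)%MS.
have Sk : (S <= kermx G)%MS by rewrite eq_row_base diffmxSl.
have hE : (h + \rank F + \rank G)%N = b.
  have := mxrank_cap_compl (kermx G) F; rewrite (capmx_idPr FK) mxrank_ker => e.
  by rewrite [(h + _)%N]addnC e subnK // rank_leq_row.
exists h => //.
have /choice[z zE] : forall i : 'I_h, exists z : kermod v, pB (val z) = row i S.
  move=> i; have [y yE] := coordinates_surj cB (row i S).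
  have /kermod_ex[z zy] : v y = 0.
    apply: (coordinates_inj cC); rewrite GE yE (coordinates0 cC); apply/sub_kermxP.
    exact: submx_trans (row_sub _ _) Sk.
  by exists z; rewrite zy.
have sumE (x : 'I_h -> R) : pB (val (\sum_i x i *: z i)) = map_mx f (\row_i x i) *m S.
  rewrite -[val _]/((val : {linear kermod v -> B}) _) linear_sum (coordinates_sum cB).
  rewrite mulmx_sum_row; apply: eq_bigr => i _.
  by rewrite linearZ (coordinatesZ cB) zE !mxE.
set T := (fun z : kermod v => `[< exists a : A, val z = u a >]).
have TP w : w \in span T <-> exists a : A, val w = u a.
  by rewrite (submod_closed_span (homology_image_closed u v)); split=> [/asboolP|?]; last apply/asboolP.
split=> [x q xm|].
  have [w ->] := mqpi_surj q; rewrite -linearZ.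
  have -> : x *: w = 0; last exact: linear0.
  by apply: val_inj; rewrite linearZ /= (coordinates_kdim0 _ cB) ?linear0.
exists (fun i => mqpi T (z i)); split=> [q|x].
  have [w ->] := mqpi_surj q.
  have : (pB (val w) <= F + S)%MS.
    have wk : (pB (val w) <= kermx G)%MS.
      by apply/sub_kermxP; rewrite -GE kermodP (coordinates0 cC).
    apply: submx_trans wk _; rewrite -(addsmx_diff_cap_eq (kermx G) F) addsmxC.
    by rewrite addsmxS // ?capmxSr // eq_row_base.
  move=> /sub_addsmxP[[X Y] /= wE].
  have [x xE] := coordinates_surj cA X; have [y yE] := map_mx_surj Y.
  pose y' := \sum_i y 0 i *: z i.
  have wE' : val w = u x + val y'.
    apply: (coordinates_inj cB); rewrite (coordinatesD cB) FE sumE wE xE.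
    by congr (_ + _ *m _); rewrite -yE; congr map_mx; apply/rowP => i; rewrite mxE.
  exists (fun i => y 0 i); transitivity (mqpi T y'); last first.
    by rewrite linear_sum; apply: eq_bigr => i _; rewrite linearZ.
  apply/mqpi_eq/TP; exists x; rewrite -[LHS]/((val : {linear kermod v -> B}) _).
  by rewrite linearB /= wE' addrK.
move=> xE i; have : \sum_i x i *: z i \in span T.
  by apply/mqpi_eq0; rewrite -[RHS]xE linear_sum; apply: eq_bigr => j _; rewrite linearZ.
move=> /TP[a' a'E].
have xS : map_mx f (\row_i x i) *m S = 0.
  apply/eqP; rewrite -submx0 -(capmx_diff (kermx G) F) sub_capmx.
  rewrite (submx_trans (submxMl _ _)) ?eq_row_base //=.
  by rewrite -sumE a'E FE submxMl.
have /rowP/(_ i) : map_mx f (\row_i x i) = 0.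
  by apply: (row_free_inj (row_base_free _)); rewrite xS mul0mx.
by rewrite !mxE => /eqP; rewrite f0.
Qed.

End KDim.

Lemma residue_field_ann a (q : residue_field m) : a \in m -> a *: q = 0.
Proof.
move=> am; have [b ->] := mqpi_surj q; rewrite -linearZ; apply/mqpi_eq0.
have [[[_ _ mc] _] _] := Rl; apply: mem_span.
by rewrite -[a *: b]/(a * b) mulrC -[_ * _]addr0 mc //; case: Rl => [[[]]].
Qed.

Lemma residue_field_eq (a b : R^o) : mqpi (m : {pred R^o}) a = mqpi (m : {pred R^o}) b -> a - b \in m.
Proof.
move=> /mqpi_eq; have [[[m0 _ mc] _] _] := Rl.
by rewrite submod_closed_span.
Qed.

(** Independence is tested in G/mG. A combination of the x i that vanishes there differs by
    coefficients in m from a relation among the x i, whose coefficients are in m by assumption. *)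
Lemma tensor_kdim (G : lmodType R) g (x : 'I_g -> G) :
  (forall y, exists a, y = row_map x a) ->
  (forall a, row_map x a = 0 -> forall j, a 0 j \in m) ->
  has_kdim m (tensor G (residue_field m)) g.
Proof.
move=> xg xm; have [[[m0 m1 mc] _] _] := Rl.
pose one : residue_field m := mqpi (m : {pred R^o}) (1 : R^o).
have oneE (q : residue_field m) : exists b, q = b *: one.
  have [b ->] := mqpi_surj q; exists b; rewrite -linearZ; congr mqpi.
  by rewrite -[RHS]/(b * 1) mulr1.
split=> [a t am|].
  pose S : {pred tensor G (residue_field m)} := fun t => a *: t == 0.
  apply/eqP; rewrite -[_ == _]/(t \in S); apply: tensor_ind => [|y q].
    split=> [|b u v]; rewrite !unfold_in /S ?scaler0 // => /eqP ua /eqP va.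
    by rewrite scalerDr scalerA mulrC -scalerA ua va scaler0 addr0.
  by rewrite unfold_in /S -pure_tensorZr residue_field_ann // -(scale0r 0) pure_tensorZr scale0r.
have oneL : linear (fun y : G => pure_tensor y one).
  by move=> a y z; rewrite pure_tensorDl pure_tensorZl.
pose e i := pure_tensor (x i) one; exists e; split=> [t|a aE j].
  have := image_submod_closed (row_map e).
  set S := (X in submod_closed X) => Sc.
  have /asboolP[a ->] : t \in S.
    apply: tensor_ind => // y q; have [a ->] := xg y; have [b ->] := oneE q.
    apply/asboolP; exists (b *: a); rewrite pure_tensorZr [RHS]linearZ; congr (_ *: _).
    rewrite -[LHS]/(mklin oneL (row_map x a)) linear_sum; apply: eq_bigr => i _.
    by rewrite linearZ.
  by exists (fun i => a 0 i).
pose S : {pred G} := fun y => `[< exists2 b : 'rV[R]_g, y = row_map x b & forall i, b 0 i \in m >].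
have Sc : submod_closed S.
  split=> [|b u v /asboolP[c -> cm] /asboolP[d -> dm]]; apply/asboolP.
    by exists 0 => [|i]; rewrite ?linear0 ?mxE.
  exists (b *: c + d) => [|i]; first by rewrite linearP.
  by rewrite !mxE mc.
have SP b : b \in m -> forall y, b *: mqpi S y = 0.
  move=> bm y; rewrite -linearZ; apply/mqpi_eq0; apply: mem_span; apply/asboolP.
  have [c ->] := xg y; exists (b *: c) => [|i]; first by rewrite linearZ.
  by rewrite !mxE mulrC -[_ * _]addr0 mc.
(* S is mG, so the choice of representative of q does not matter. *)
pose bil (y : G) (q : residue_field m) : modquot S := (repr q : R) *: mqpi S y.
have bilE y b : bil y (mqpi (m : {pred R^o}) b) = (b : R) *: mqpi S y.
  apply/eqP; rewrite -subr_eq0 -scalerBl; apply/eqP/SP/residue_field_eq.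
  by rewrite mqpi_repr.
have [||w wE] := @tensor_lift R G (residue_field m) (modquot S) bil.
- move=> q b y z; rewrite /bil linearP scalerDr !scalerA.
  by congr (_ *: _ + _); rewrite mulrC.
- move=> y b q r; have [[c ->] [d ->]] := (mqpi_surj q, mqpi_surj r).
  by rewrite -linearP !bilE scalerDl scalerA.
have /(congr1 w) := aE; rewrite linear0 linear_sum /= => h.
have : mqpi S (row_map x (\row_i a i)) = 0.
  rewrite -[RHS]h linear_sum; apply: eq_bigr => i _.
  by rewrite [RHS]linearZ linearZ wE bilE scale1r mxE.
move=> /mqpi_eq0; rewrite submod_closed_span // => /asboolP[b bE bm].
have e0 : row_map x (\row_i a i - b) = 0 by rewrite [LHS]linearB [X in X - _]bE subrr.
have := xm _ e0 j.
by rewrite !mxE => abm; rewrite -[a j](subrK (b 0 j)) -[_ - _]mul1r mc.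
Qed.

End Local.

(** * The G-Euler characteristic *)

Section Euler.
Variables (R : comNzRingType) (m : {pred R}).
Hypotheses (Rn : noetherian R) (Rl : local_ring m).
Implicit Types K G M : lmodType R.
Local Notation kappa := (residue_field m).

Lemma Gbetti_proper M (X : augmented M) n h : proper_Gresolution X ->
  has_kdim m (tensor_homology X kappa n) h -> Gbetti m M n = h.
Proof.
move=> Xp Xh; have [k [f [f0 fs]]] := residue_class_field Rn Rl.
apply: xget_unique => [|d [Y Yp Yd]]; first by exists X.
have [u ui] := tensor_homology_injection kappa n Xp Yp.
have [v vi] := tensor_homology_injection kappa n Yp Xp.
apply/eqP; rewrite eqn_leq (kdim_injective_le f0 fs ui Xh Yd).
by rewrite (kdim_injective_le f0 fs vi Yd Xh).
Qed.

(** The rank of each differential enters the count in two consecutive degrees, with opposite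
    signs. *)
Lemma Geuler_proper M (X : augmented M) (c : nat -> nat) N : proper_Gresolution X ->
  (forall n, has_kdim m (tensor (X n) kappa) (c n)) ->
  (forall n, (N <= n)%N -> c n = 0%N) ->
  Geuler m M = \sum_(n < N) (-1) ^+ n * (c n)%:Z.
Proof.
move=> Xp Xc c0; have [k [f [f0 fs]]] := residue_class_field Rn Rl.
have phi n := cid (coordinates_ex f0 fs (Xc n)).
have D n := cid (coordinates_mx fs (tensor_map kappa (cdiff X n))
  (projT2 (phi n.+1)) (projT2 (phi n))).
pose rho n := if n is n'.+1 then \rank (projT1 (D n')) else 0%N.
have betaE n : (Gbetti m M n + rho n.+1 + rho n)%N = c n.
  case: n => [|n].
    have [||h hk <-] := homology_kdim f0 fs (projT2 (phi 1%N)) (projT2 (phi 0%N))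
      (projT2 (phi 0%N)) (u := tensor_map kappa (cdiff X 0%N))
      (v := tensor_map kappa (cdiff_out X 0%N)) (G := 0) (projT2 (D 0%N)).
    - by move=> x; rewrite tensor_map0 // (coordinates0 (projT2 (phi 0%N))) mulmx0.
    - by move=> x; rewrite tensor_map0.
    - by rewrite mxrank0 (Gbetti_proper Xp hk).
  have [|h hk <-] := homology_kdim f0 fs (projT2 (phi n.+2)) (projT2 (phi n.+1))
      (projT2 (phi n)) (projT2 (D n.+1)) (projT2 (D n)).
    by move=> x; rewrite tensor_map_comp tensor_map0 // => y; apply: cdiffK.
  by rewrite (Gbetti_proper (n := n.+1) Xp hk).
have beta0 n : (N <= n)%N -> Gbetti m M n = 0%N.
  by move=> /c0; rewrite -betaE => /eqP; rewrite !addn_eq0 => /andP[/andP[/eqP]].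
(* The telescoping sum leaves the rank of the differential out of degree N, which is 0 because c N =
   0. *)
have rhoN : rho N = 0%N.
  by have /eqP := c0 N (leqnn N); rewrite -betaE !addn_eq0 => /andP[_ /eqP].
have -> : Geuler m M = \sum_(n < N) (-1) ^+ n * (Gbetti m M n)%:Z.
  rewrite /Geuler -(fsbig_widen `I_N setT) //; last first.
    by move=> n /= [_ /negP]; rewrite -leqNgt => /beta0 ->; rewrite mulr0.
  by rewrite -fsbig_ord.
apply/eqP; rewrite -subr_eq0 -sumrB; apply/eqP.
pose S n : int := (-1) ^+ n * (rho n)%:Z.
rewrite (eq_bigr (fun n : 'I_N => S n.+1 - S n)) => [|n _].
  rewrite -(big_mkord xpredT (fun n => S n.+1 - S n)) telescope_sumr //.
  by rewrite /S rhoN !mulr0 subrr.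
by rewrite -betaE !PoszD /S exprS; ring.
Qed.

Lemma totally_reflexive_Geuler d K G M g c (i : {linear K -> G}) (p : {linear G -> M})
    (q : {linear 'rV[R]_g -> G}) :
  short_exact i p -> totally_reflexive G -> finite_free d K c ->
  (forall y, exists x, y = q x) -> (forall x, q x = 0 -> forall j, x 0 j \in m) ->
  Geuler m M = g%:Z - c.
Proof.
move=> ip hG hK qs qm.
have [X [b [XE Xe Xh b0 ->]]] := finite_free_resolution Rn hK.
have mz : 0 \in m by case: Rl => [[[]]].
have Xp : proper_Gresolution (splice ip X).
  split; first apply: splice_resolution => //.
    by split=> // n; rewrite XE; apply: row_totally_reflexive.
  move=> H hH; apply: splice_hom_exact; first exact: Xh.
  exact: ext1_lift ip (ext1_finite_free Rn hH hK).
rewrite (@Geuler_proper _ _ (fun n => if n is n'.+1 then b n' else g) d.+1 Xp).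
- rewrite big_ord_recl /= expr0 mul1r; congr (_ + _); rewrite -sumrN.
  by apply: eq_bigr => n _; rewrite /= exprS mulN1r mulNr.
- case=> [|n] /=.
    apply: (tensor_kdim Rl (x := fun j => q (delta_mx 0 j))) => [y|a].
      by have [x ->] := qs y; exists x; rewrite row_mapE.
    by rewrite -row_mapE; apply: qm.
  rewrite XE; apply: (tensor_kdim Rl (x := fun j => delta_mx 0 j)) => [y|a].
    by exists y; rewrite -(row_mapE idfun).
  by rewrite -(row_mapE idfun) /= => -> j; rewrite mxE.
- by case=> // n; apply: b0.
Qed.

(* The retraction r makes the d-th syzygy of M a direct summand of a free module. *)
Lemma split_finite_free d M (Y : augmented M) (r : {linear aterm Y d -> aterm Y d.+1}) :
  resolution (@free_row R) Y ->
  (forall x, adiff Y d (r (adiff Y d x)) = adiff Y d x) ->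
  exists c, finite_free d.+1 M c.
Proof.
elim: d M Y r => [|d IH] M Y r [Yf Ye] rE; have /aug_exactP[Ys _] := Ye.
  have [n YE] := Yf 0%N.
  (* At d = 0 the map r is a section of the augmentation, so M is a retract of a free module. *)
  have Mp : projective M.
    move=> A B p u ps; have [v vE] := free_row_projective (Yf 0%N) (u \o aug Y) ps.
    by exists (v \o r) => x; have [y ->] := Ys x; rewrite [RHS]/= -vE; congr (u _); exact: esym (rE y).
  have Mf : fin_gen M.
    by apply: fin_gen_surj Ys _; rewrite YE; apply: fin_gen_row.
  have [g [q qb]] := projective_free Rn Rl Mf Mp.
  have [q' qK Kq] := linear_bij_inv qb.
  exists g%:Z, g, 'rV[R]_0, \0, q; split; last first.
    by split; [move=> x; apply/rowP => -[] | rewrite subrr].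
  split=> [x y _|x|y]; first by apply/rowP => -[].
  - split=> [x0|[a ->]]; last exact: linear0.
    by exists 0; apply: (can_inj qK); rewrite x0 [RHS]linear0.
  - by exists (q' y); rewrite Kq.
have sY : resolution (@free_row R) (shift Y).
  by split; [move=> n; apply: Yf | apply: shift_exact].
suff [c hc] : exists c, finite_free d.+1 (kermod (aug Y)) c.
  have [n YE] := Yf 0%N.
  (* P is generalised so that the equation [YE] can be substituted in the types of the maps. *)
  have gen (P : lmodType R) : P = 'rV[R]_n -> forall (i : {linear kermod (aug Y) -> P}) (p : {linear P -> M}),
      short_exact i p -> exists c, finite_free d.+2 M c.
    move=> -> i p ip; exists (n%:Z - c), n, (kermod (aug Y)), i, p.
    by split=> //; rewrite subKr.
  exact: (gen _ YE _ _ (short_exact_ker Ys)).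
(* At the bottom, shifting puts the kernel of the augmentation in place of Y 0, so r has to be
   restricted to it. *)
case: d r rE IH => [|d] r rE IH; last exact: (IH _ (shift Y) r sY).
apply: (IH _ (shift Y) (r \o (val : {linear kermod (aug Y) -> Y 0%N})) sY) => x.
by apply: val_inj; rewrite /= !shift_augE; apply: rE.
Qed.

(** The identity of a free resolution Y by finitely generated modules is homotopic to a map through
    X, which is 0 above degree d. There the homotopy provides the retraction for
    [split_finite_free]. *)
Lemma finite_pdim_finite_free M : fin_gen M -> finite_pdim M ->
  exists d c, finite_free d.+1 M c.
Proof.
move=> Mf [d [X [Xp Xe] X0]].
have [Y Yf] := fin_gen_resolution Rn Mf.
have [Yp Ye] := resolution_free_projective Yf.
have XP H (Hp : projective H) := projective_hom_aug_exact Hp Xe.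
have YP H (Hp : projective H) := projective_hom_aug_exact Hp Ye.
have [f [f0 fE]] := comparison Yp XP idfun.
have [g [g0 gE]] := comparison Xp YP idfun.
pose e k : {linear aterm Y k -> aterm Y k} := idfun \- (g k \o f k).
have e0 x : e 0%N x = 0 by rewrite /e /= g0 f0 /= subrr.
have eE k x : adiff Y k (e k.+1 x) = e k (adiff Y k x).
  by rewrite /e /= linearB gE fE.
have [h h0 hE] := null_homotopy Yp YP e0 eE.
exists d.+1; apply: (@split_finite_free d.+1 M Y (h d.+1) Yf) => x.
have := congr1 (adiff Y d.+1) (hE d.+1 x).
have fx0 : f d.+2 x = 0 := X0 d.+1 (ltnSn d) _.
rewrite [RHS]linearD [X in X + _]adiffK add0r => <-.
by rewrite /e [X in adiff _ _ X]/= fx0 linear0 subr0.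
Qed.

End Euler.

Theorem theorem1 (R : comNzRingType) (m : {pred R}) (M : lmodType R) :
  noetherian R -> local_ring m -> fin_gen M -> finite_Gdim M ->
  (Geuler m M = 0 <->
   finite_pdim M /\ exists r : R, Ann M r /\ GRing.lreg r).
Proof.
move=> Rn Rl Mf [d [X Xr X0]]; split=> [chi0|[Mp [r [rM rr]]]].
  have [K [G [i [p [ip hG [e [c hK]]]]]]] :=
    totally_reflexive_approximation Rn (finite_chain_resolution (d := d.+1) Xr X0).
  have [Gf _ _] := hG; have [g [q [qs qm]]] := minimal_generators Rn Rl Gf.
  have /eqP := totally_reflexive_Geuler Rn Rl ip hG hK qs qm.
  rewrite chi0 eq_sym subr_eq0 => /eqP cE; rewrite -cE in hK.
  have collapse s (sm : maximal_annihilator s) := generic_collapse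
    (proj1 sm) (fun a b => @maximal_annihilator_prime R s a b sm) ip qs hK.
  (* A nonzero coordinate of a relation would have its annihilator inside some maximal Ann(s), but
     [collapse] kills the relation by a scalar outside Ann(s). *)
  have qi : injective q.
    apply: linear_injP => x x0; apply/rowP => j; rewrite mxE; apply: contrapT.
    move=> /(maximal_annihilator_ex Rn)[s [sm sx]].
    have [_ [a sa /(_ _ x0)/rowP/(_ j)]] := collapse s sm.
    by rewrite !mxE => /sx.
  have [q' qK Kq] := linear_bij_inv (linear_bijP qi qs).
  split.
    have [Y [b [YE Ye _ b0 _]]] := finite_free_resolution Rn hK.
    exists e; exists (splice ip Y).
      apply: splice_resolution; last first.
        by split=> // n; rewrite YE; apply: projective_row.
      move=> A B f u fs; have [v vE] := @projective_row R g _ _ f (u \o q) fs.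
      by exists (v \o q') => x; rewrite /= -vE /= Kq.
    case=> // n en; rewrite [splice ip Y n.+1]YE b0 // => x.
    by apply/rowP => -[].
  have [||r /asboolP rM rr] := @regular_element R Rn (fun r : R^o => `[< Ann M r >]).
  - split=> [|a u v /asboolP uM /asboolP vM]; apply/asboolP => x; first exact: scale0r.
    by rewrite scalerDl -scalerA uM vM scaler0 addr0.
  - move=> s sm; have [[a sa aM] _] := collapse s sm.
    by exists a => //; apply/asboolP.
  by exists r.
have [e [c hM]] := finite_pdim_finite_free Rn Rl Mf Mp.
(* Any single associated prime suffices to compute the rank; one exists above Ann(1) = 0. *)
have [s [sm _]] := maximal_annihilator_ex Rn (elimN eqP (oner_neq0 R)).
have c0 : c = 0.
  exact: (finite_free_ann (proj1 sm) (fun a b => @maximal_annihilator_prime R s a b sm) hM rr rM).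
have [b [K [i [p [ip hK]]]]] := hM.
(* The free module R^b is totally reflexive and minimally covers itself, so the formula gives b - (b
   - c) = c. *)
rewrite (totally_reflexive_Geuler Rn Rl (q := idfun) ip (@row_totally_reflexive R b) hK).
- by rewrite c0 subr0 subrr.
- by move=> y; exists y.
- by move=> x /= -> j; rewrite mxE; case: Rl => [[[]]].
Qed.
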